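(* For every integer $n\ge 3$ the $(n+5)$-point quadrature formula $$Q_{n+5}[f]=-\frac{1}{12n}\sigma(0)+\frac{8}{9n}\sigma\Big(\frac1{4n}\Big)-\frac{1}{3n}\sigma\Big(\frac1{2n}\Big)+\frac{37}{36n}\sigma\Big(\frac1n\Big)+\frac1n\sum_{k=2}^{n-2}f\Big(\frac kn\Big),\qquad \sigma(x):=f(x)+f(1-x),$$ is positive definite of order $4$, with error constant $$c_4(Q_{n+5})=\frac{1}{720\,n^4}\Big(1-\frac{5}{8\,n}\Big),$$ and the sequence $\{Q_{n+5}\}$ is asymptotically optimal positive definite of order $4$, i.e. $\lim_{n\to\infty}c_4(Q_{n+5})/c^{+}_{n+5,4}=1$.
   Context: An $N$-point quadrature formula is a functional $Q[f]=\sum_{i=1}^{N}a_i f(\tau_i)$ with nodes $0\le\tau_1<\dots<\tau_N\le 1$ and real weights; its remainder is $R[Q;f]=\int_0^1 f(x)\,dx-Q[f]$. $Q$ is positive definite of order $4$, with error constant $c_4(Q)$, if there is a constant $c_4(Q)>0$ such that for every $f\in C^4[0,1]$ there is $\xi\in[0,1]$ with $R[Q;f]=c_4(Q)f^{(4)}(\xi)$. $c^{+}_{N,4}$ denotes the infimum of $c_4(Q)$ over all $N$-point positive definite quadrature formulae $Q$ of order $4$. Empty sums are $0$. *)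

(* Defs.v *)
(* Stdlib real numbers, with Coquelicot for integrals, infima and limits. *)
From Stdlib Require Import Reals Lra Lia.
From Coquelicot Require Import Coquelicot.
Open Scope R_scope.

Definition I01 (x : R) : Prop := 0 <= x <= 1.

(* Differentiability is relative to [0,1], hence one-sided at 0 and 1; values of
   functions R -> R outside [0,1] are never constrained. *)
Definition derivative_on_I01 (f g : R -> R) : Prop :=
  forall x, I01 x -> D_in f g I01 x.

(* [f] is of class C^4 on [0,1] and its fourth derivative there is [f4]. *)
Definition C4_I01 (f f4 : R -> R) : Prop :=
  exists f1 f2 f3 : R -> R,
    derivative_on_I01 f f1 /\ derivative_on_I01 f1 f2 /\
    derivative_on_I01 f2 f3 /\ derivative_on_I01 f3 f4 /\
    (forall x, I01 x -> continue_in f4 I01 x).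

(* Nodes and weights are indexed by 1, ..., N; their values at other indices
   are irrelevant. *)
Definition quadrature_formula (N : nat) (Q : (R -> R) -> R) : Prop :=
  exists a tau : nat -> R,
    (forall i, (1 <= i <= N)%nat -> 0 <= tau i <= 1) /\
    (forall i j, (1 <= i)%nat -> (i < j)%nat -> (j <= N)%nat -> tau i < tau j) /\
    (forall f : R -> R, Q f = sum_n_m (fun i => a i * f (tau i)) 1 N).

Definition remainder (Q : (R -> R) -> R) (f : R -> R) : R := RInt f 0 1 - Q f.

Definition is_error_constant4 (Q : (R -> R) -> R) (c : R) : Prop :=
  0 < c /\
  forall f f4 : R -> R, C4_I01 f f4 ->
    exists xi, 0 <= xi <= 1 /\ remainder Q f = c * f4 xi.

Definition positive_definite4 (Q : (R -> R) -> R) : Prop :=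
  exists c : R, is_error_constant4 Q c.

(* "The" error constant: it is unique when it exists, see [c4_unique]. *)
Definition c4 (Q : (R -> R) -> R) : R :=
  @iota R_CompleteNormedModule (is_error_constant4 Q).

Definition c4_plus (N : nat) : R :=
  real (Glb_Rbar (fun c => exists Q : (R -> R) -> R,
    quadrature_formula N Q /\ positive_definite4 Q /\ c = c4 Q)).

Definition sigma (f : R -> R) (x : R) : R := f x + f (1 - x).

(* The (n+5)-point formula; [sum_n_m] is 0 when its upper bound is below its
   lower bound, which happens for n = 3. *)
Definition Qn5 (n : nat) (f : R -> R) : R :=
  - (1 / (12 * INR n)) * sigma f 0
  + 8 / (9 * INR n) * sigma f (1 / (4 * INR n))
  - 1 / (3 * INR n) * sigma f (1 / (2 * INR n))
  + 37 / (36 * INR n) * sigma f (1 / INR n)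
  + 1 / INR n * sum_n_m (fun k => f (INR k / INR n)) 2 (n - 2).

Lemma C4_I01_pow4 : C4_I01 (fun x => x ^ 4) (fun _ => 24).
Proof.
exists (fun x => 4 * x ^ 3), (fun x => 12 * x ^ 2), (fun x => 24 * x).
assert (H : forall (f g h : R -> R), (forall x, D_in f g no_cond x) ->
  (forall x, g x = h x) -> derivative_on_I01 f h).
{ intros f g h Hf Hgh x _. apply D_in_ext with g; [apply Hgh|].
  apply D_in_imp with no_cond; [intros; exact I | apply Hf]. }
repeat split.
- eapply H; [intro x; apply Dx_pow_n | intro x; simpl; ring].
- eapply H; [intro x; apply Dmult_const, Dx_pow_n | intro x; simpl; ring].
- eapply H; [intro x; apply Dmult_const, Dx_pow_n | intro x; simpl; ring].
- eapply H; [intro x; apply Dmult_const, Dx | intro x; simpl; ring].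
- intros x _. apply cont_deriv with (fun _ => 0). apply Dconst.
Qed.

Lemma c4_unique (Q : (R -> R) -> R) (c : R) : is_error_constant4 Q c -> c4 Q = c.
Proof.
intro Hc. apply (@iota_unique _ R_CompleteNormedModule); [|exact Hc].
intros d [_ Hd]. destruct Hc as [_ Hc].
destruct (Hd _ _ C4_I01_pow4) as [x [_ Hx]].
destruct (Hc _ _ C4_I01_pow4) as [y [_ Hy]].
simpl in d |- *. lra.
Qed.

(* Main.v *)
Require Import Defs.
From Stdlib Require Import Reals.
From Coquelicot Require Import Coquelicot.
From Stdlib Require Import Lra Lia Psatz List Permutation Sorted.
From Stdlib Require Import Classical ClassicalEpsilon.
Open Scope R_scope.

(** Write [pp] for the positive part. The remainder of a formula with weights [a]
    and nodes [tau] is the integral of [K f''''], where the Peano kernel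
    [K x = x^4 / 24 - sum a pp (x - tau)^3 / 6] is a monospline of degree 4, and
    the error constant is the integral of [K] when [K >= 0].

    For the [n + 5] points, [K] is the kernel [(x - u)^2 (v - x)^2 / 24] of the
    corrected trapezoidal rule on each interior interval [[u, v]] of length
    [1 / n]. Next to the end points the additional nodes carry [K] from 0, where
    [K], [K'] and [K''] vanish, to that kernel, and [K >= 0] remains true
    ([left_block], [right_block], [interior_blocks], [Qn5_lower]). A continuous
    fourth derivative takes its weighted mean value, whence
    [error_constant_Qn5].

    Optimality amounts to a lower bound, asymptotic to [1 / (720 N^4)], for the
    integral of a nonnegative kernel [K] with [N] knots ([mono_lower]). If all
    weights [a] are nonnegative, the integral of [K K''''] gives
    [int K >= int (K'')^2], and [K''] is a quadratic spline with leading
    coefficient [1 / 2], so that Legendre polynomials and convexity yield the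
    bound. For weights of any sign, [K] is replaced by a spline [f <= K] with
    [f'''' = 1 - b] for a probability measure [b], that is, a constant minus the
    potential [pot] of [b]; the same computation applies to [f]. The measure [b]
    minimises [1/2 int (f'')^2 + int K db], the functional [Theta], among the
    probability measures with a given number of points; minimisers exist by
    compactness ([Theta_min_exists]). If allowing one more point does not decrease
    the minimum, the difference [K - f] attains its minimum on the support of [b]
    ([potential_lower]), and integrating this gives the bound. If it does, the
    points of a minimiser with the larger number of points are distinct, [K - f]
    takes the same value at all of them and is critical at those inside [(0, 1)]
    ([potential_support], [potential_critical]), and Rolle's theorem shows that
    there are at most [N + 4] of them ([count_points]). So the first case occurs
    for [N + 4] points. *)

(* Reads an equation in a Coquelicot structure on [R] as an equation in [R]. *)
Ltac eqR := lazymatch goal with |- ?a = ?b => change (@eq R a b) end.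

(** * Finite measures as lists of weighted points *)

(** The integral of [F] against the measure [sum b delta_y], the pairs
    [(b, y)] running over [l]. *)
Fixpoint lsum (F : R -> R) (l : list (R * R)) : R :=
  match l with
  | nil => 0
  | p :: l' => fst p * F (snd p) + lsum F l'
  end.

Lemma lsum_ext (F G : R -> R) (l : list (R * R)) :
  (forall p, In p l -> F (snd p) = G (snd p)) -> lsum F l = lsum G l.
Proof.
induction l as [|p l IH]; intro H; simpl; [reflexivity|].
rewrite (H p (or_introl eq_refl)), IH; [reflexivity|].
intros; apply H; now right.
Qed.

Lemma lsum_lin (u v : R) (F G : R -> R) (l : list (R * R)) :
  lsum (fun x => u * F x + v * G x) l = u * lsum F l + v * lsum G l.
Proof. induction l as [|p l IH]; simpl; [ring|rewrite IH; ring]. Qed.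

Lemma lsum_plus (F G : R -> R) (l : list (R * R)) :
  lsum (fun x => F x + G x) l = lsum F l + lsum G l.
Proof. induction l as [|p l IH]; simpl; [ring|rewrite IH; ring]. Qed.

Lemma lsum_scal (u : R) (F : R -> R) (l : list (R * R)) :
  lsum (fun x => u * F x) l = u * lsum F l.
Proof. induction l as [|p l IH]; simpl; [ring|rewrite IH; ring]. Qed.

Lemma lsum_perm (F : R -> R) (l1 l2 : list (R * R)) :
  Permutation l1 l2 -> lsum F l1 = lsum F l2.
Proof.
induction 1 as [|x l l' _ IH|x y l|l l' l'' _ IH1 _ IH2]; simpl.
- reflexivity.
- rewrite IH; ring.
- ring.
- now rewrite IH1.
Qed.

Lemma lsum_nonneg (F : R -> R) (l : list (R * R)) :
  (forall p, In p l -> 0 <= fst p * F (snd p)) -> 0 <= lsum F l.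
Proof.
induction l as [|p l IH]; intro H; simpl; [lra|].
assert (H1 := H p (or_introl eq_refl)).
assert (H2 : 0 <= lsum F l) by (apply IH; intros; apply H; now right).
lra.
Qed.

Lemma lsum_scale (t : R) (F : R -> R) (l : list (R * R)) :
  lsum F (map (fun p => (t * fst p, snd p)) l) = t * lsum F l.
Proof. induction l as [|p l IH]; simpl; [ring|rewrite IH; ring]. Qed.

Lemma is_RInt_lsum (F : R -> R -> R) (I : R -> R) (u v : R) (l : list (R * R)) :
  (forall p, In p l -> is_RInt (F (snd p)) u v (I (snd p))) ->
  is_RInt (fun x => lsum (fun y => F y x) l) u v (lsum I l).
Proof.
induction l as [|p l IH]; intro H; simpl.
- assert (E := is_RInt_const u v 0). unfold scal in E; simpl in E;
  unfold mult in E; simpl in E. now rewrite Rmult_0_r in E.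
- apply @is_RInt_plus.
  + apply (is_RInt_scal (F (snd p)) u v (fst p)). apply H. now left.
  + apply IH. intros; apply H; now right.
Qed.

Lemma is_derive_lsum (F F' : R -> R -> R) (x : R) (l : list (R * R)) :
  (forall y, is_derive (F y) x (F' y x)) ->
  is_derive (fun x => lsum (fun y => F y x) l) x (lsum (fun y => F' y x) l).
Proof.
intro H. induction l as [|p l IH]; simpl.
- apply (is_derive_const 0).
- apply @is_derive_plus; [|exact IH].
  apply (is_derive_scal (F (snd p)) x (fst p)), H.
Qed.

(** * Truncated powers *)

(** The positive part of [x]. *)
Definition pp (x : R) : R := Rmax x 0.

Lemma pp_pos (x : R) : 0 <= x -> pp x = x.
Proof. intro; unfold pp; rewrite Rmax_left; lra. Qed.

Lemma pp_neg (x : R) : x <= 0 -> pp x = 0.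
Proof. intro; unfold pp; rewrite Rmax_right; lra. Qed.

Lemma pp_ge0 (x : R) : 0 <= pp x.
Proof. apply Rmax_r. Qed.

Lemma pp_lip (x y : R) : Rabs (pp x - pp y) <= Rabs (x - y).
Proof.
unfold pp, Rmax.
destruct (Rle_dec x 0), (Rle_dec y 0); unfold Rabs;
  destruct (Rcase_abs _), (Rcase_abs (x - y)); lra.
Qed.

Lemma continuous_pp (x : R) : continuous pp x.
Proof.
apply filterlim_locally. intros eps. exists eps. intros y Hy.
change (Rabs (pp y - pp x) < eps). change (Rabs (y - x) < eps) in Hy.
assert (H := pp_lip y x). lra.
Qed.

Lemma is_derive_pp (k : nat) (x : R) :
  is_derive (fun x => pp x ^ (k + 2)) x (INR (k + 2) * pp x ^ (k + 1)).
Proof.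
destruct (total_order_T x 0) as [[Hx|Hx]|Hx].
- apply is_derive_ext_loc with (fun _ => 0).
  + exists (mkposreal (- x) ltac:(lra)). intros y Hy.
    change (Rabs (y - x) < - x) in Hy. apply Rabs_def2 in Hy.
    rewrite pp_neg by lra. rewrite pow_i; [reflexivity|lia].
  + rewrite pp_neg by lra. rewrite pow_i by lia. rewrite Rmult_0_r.
    apply (is_derive_const 0).
(* At 0, the difference quotient is bounded by [|h|] for [|h| < 1]. *)
- subst x. rewrite (pp_neg 0) by lra. rewrite (pow_i (k+1)) by lia.
  rewrite Rmult_0_r. apply is_derive_Reals.
  intros eps Heps.
  exists (mkposreal (Rmin eps 1) ltac:(apply Rmin_pos; lra)).
  intros h Hh0 Hh. simpl in Hh.
  assert (Hh1 : Rabs h < eps) by (eapply Rlt_le_trans; [exact Hh|apply Rmin_l]).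
  assert (Hh2 : Rabs h < 1) by (eapply Rlt_le_trans; [exact Hh|apply Rmin_r]).
  rewrite (pp_neg 0), (pow_i (k+2)) by (lra || lia).
  rewrite Rplus_0_l, !Rminus_0_r.
  destruct (Rle_dec 0 h) as [H|H].
  + rewrite pp_pos by lra. rewrite Rabs_right in Hh1, Hh2 by lra.
    replace (h ^ (k + 2) / h) with (h * h ^ k)
      by (rewrite pow_add; simpl; field; exact Hh0).
    assert (0 <= h ^ k <= 1).
    { split; [apply pow_le; lra|]. rewrite <- (pow1 k). apply pow_incr; lra. }
    rewrite Rabs_right; nra.
  + rewrite pp_neg by lra. rewrite pow_i by lia.
    unfold Rdiv. rewrite Rmult_0_l, Rabs_R0. lra.
- apply is_derive_ext_loc with (fun x => x ^ (k + 2)).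
  + exists (mkposreal x Hx). intros y Hy.
    change (Rabs (y - x) < x) in Hy. apply Rabs_def2 in Hy.
    rewrite pp_pos by lra. reflexivity.
  + rewrite pp_pos by lra. auto_derive; [exact I|].
    replace (Init.Nat.pred (k + 2)) with (k + 1)%nat by lia. ring.
Qed.

Lemma is_derive_pp_r (k : nat) (s x : R) :
  is_derive (fun x => pp (x - s) ^ (k + 2)) x (INR (k + 2) * pp (x - s) ^ (k + 1)).
Proof.
rewrite <- (Rmult_1_l (INR (k+2) * _)).
apply (is_derive_comp (fun x => pp x ^ (k + 2)) (fun x => x - s)).
- apply is_derive_pp.
- auto_derive; [exact I|ring].
Qed.

Lemma is_derive_pp_l (k : nat) (s x : R) :
  is_derive (fun x => pp (s - x) ^ (k + 2)) x (- (INR (k + 2) * pp (s - x) ^ (k + 1))).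
Proof.
replace (- (INR (k + 2) * pp (s - x) ^ (k + 1)))
  with (-1 * (INR (k + 2) * pp (s - x) ^ (k + 1))) by ring.
apply (is_derive_comp (fun x => pp x ^ (k + 2)) (fun x => s - x)).
- apply is_derive_pp.
- auto_derive; [exact I|ring].
Qed.

Lemma continuous_of_derive (f : R -> R) (x d : R) : is_derive f x d -> continuous f x.
Proof. intro H. apply (ex_derive_continuous f). now exists d. Qed.

(** The fundamental theorem of calculus, for a continuous integrand. *)
Lemma is_RInt_primitive (f g : R -> R) (u v I : R) :
  (forall x, is_derive f x (g x)) -> (forall x, continuous g x) ->
  I = f v - f u -> is_RInt g u v I.
Proof.
intros Hd Hc ->. apply (is_RInt_derive f g); intros; [apply Hd|apply Hc].
Qed.

(** * The kernel of the energy *)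

(** [psi2 y] is the second derivative of the function [psi] with
    [psi'''' = 1 - delta_y] and [psi' = psi''' = 0] at both ends of [[0,1]]. *)
Definition psi2 (y x : R) : R := x ^ 2 / 2 - 1 / 6 + (1 - y) ^ 2 / 2 - pp (x - y).

(** The Green function of the fourth derivative for these boundary conditions:
    [(d/du)^4 green u v = delta_v - 1], normalised to have mean value 0. *)
Definition green (u v : R) : R :=
  - u ^ 4 / 24 + (1 / 6 - (1 - v) ^ 2 / 2) * u ^ 2 / 2 + pp (u - v) ^ 3 / 6
  + 1 / 120 - 1 / 36 + (1 - v) ^ 2 / 12 - (1 - v) ^ 4 / 24.

Lemma green_sym (u v : R) : green u v = green v u.
Proof.
unfold green. destruct (Rle_dec u v).
- rewrite (pp_neg (u - v)), (pp_pos (v - u)) by lra. field.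
- rewrite (pp_pos (u - v)), (pp_neg (v - u)) by lra. field.
Qed.

Lemma is_derive_pp_comb (c2 c3 c4 s x : R) :
  is_derive (fun x => c2 * pp (x - s) ^ 2 + c3 * pp (x - s) ^ 3 + c4 * pp (x - s) ^ 4) x
    (c2 * (2 * pp (x - s)) + c3 * (3 * pp (x - s) ^ 2) + c4 * (4 * pp (x - s) ^ 3)).
Proof.
assert (A : forall c k, is_derive (fun x => c * pp (x - s) ^ (k + 2)) x
  (c * (INR (k + 2) * pp (x - s) ^ (k + 1)))).
{ intros c k. apply (is_derive_scal (fun x => pp (x - s) ^ (k + 2)) x c), is_derive_pp_r. }
assert (A0 := A c2 0%nat). assert (A1 := A c3 1%nat). assert (A2 := A c4 2%nat).
simpl Nat.add in A0, A1, A2. simpl INR in A0, A1, A2.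
rewrite pow_1 in A0.
replace (1 + 1 + 1) with 3 in A1 by ring.
replace (1 + 1 + 1 + 1) with 4 in A2 by ring.
replace (1 + 1) with 2 in A0 by ring.
apply @is_derive_plus; [apply @is_derive_plus|]; assumption.
Qed.

Lemma continuous_pp_r (s x : R) : continuous (fun x => pp (x - s)) x.
Proof.
apply (continuous_comp (fun x => x - s) pp); [|apply continuous_pp].
apply (continuous_of_derive _ _ 1). auto_derive; [exact I|ring].
Qed.

Lemma continuous_psi2 (y x : R) : continuous (psi2 y) x.
Proof.
unfold psi2. apply (continuous_minus (fun x => x ^ 2 / 2 - 1 / 6 + (1 - y) ^ 2 / 2)
  (fun x => pp (x - y))); [|apply continuous_pp_r].
apply (continuous_of_derive _ _ x). auto_derive; [exact I|simpl; field].
Qed.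

(** The quadratic form of the Green function is an [L^2] norm. *)
Lemma is_RInt_psi2_psi2 (u v : R) : 0 <= u <= 1 -> 0 <= v <= 1 ->
  is_RInt (fun x => psi2 u x * psi2 v x) 0 1 (green u v).
Proof.
assert (A : forall u v, 0 <= u <= 1 -> 0 <= v <= 1 -> u <= v ->
  is_RInt (fun x => psi2 u x * psi2 v x) 0 1 (green u v)).
{ clear u v; intros u v Hu Hv Huv.
  set (Au := - (1 / 6) + (1 - u) ^ 2 / 2). set (Av := - (1 / 6) + (1 - v) ^ 2 / 2).
  apply (is_RInt_primitive (fun x =>
    (x ^ 5 / 20 + (Au + Av) * x ^ 3 / 6 + Au * Av * x)
    + ((- (v ^ 2 / 2 + Au) / 2 + (v - u) / 2) * pp (x - v) ^ 2
       + (- v / 3 + 1 / 3) * pp (x - v) ^ 3 + (- 1 / 8) * pp (x - v) ^ 4)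
    + ((- (u ^ 2 / 2 + Av) / 2) * pp (x - u) ^ 2
       + (- u / 3) * pp (x - u) ^ 3 + (- 1 / 8) * pp (x - u) ^ 4))).
  - intro x. evar_last.
    + apply @is_derive_plus; [apply @is_derive_plus|];
        [|apply is_derive_pp_comb|apply is_derive_pp_comb].
      auto_derive; [exact I|reflexivity].
    + simpl. unfold plus; simpl. unfold psi2.
      destruct (Rle_dec x u); [|destruct (Rle_dec x v)].
      * rewrite (pp_neg (x - u)), (pp_neg (x - v)) by lra. unfold Au, Av. field.
      * rewrite (pp_pos (x - u)), (pp_neg (x - v)) by lra. unfold Au, Av. field.
      * rewrite (pp_pos (x - u)), (pp_pos (x - v)) by lra. unfold Au, Av. field.
  - intro x. apply (continuous_mult (psi2 u) (psi2 v)); apply continuous_psi2.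
  - unfold green. rewrite (pp_neg (0 - u)), (pp_neg (0 - v)), (pp_neg (u - v)),
      (pp_pos (1 - u)), (pp_pos (1 - v)) by lra. unfold Au, Av. field. }
intros Hu Hv. destruct (Rle_dec u v).
- now apply A.
- rewrite green_sym. apply is_RInt_ext with (fun x => psi2 v x * psi2 u x).
  + intros; apply Rmult_comm.
  + apply A; lra.
Qed.

(** The first two derivatives of [green (.) v]. *)
Definition green1 (u v : R) : R :=
  - u ^ 3 / 6 + (1 / 6 - (1 - v) ^ 2 / 2) * u + pp (u - v) ^ 2 / 2.
Definition green2 (u v : R) : R :=
  - u ^ 2 / 2 + (1 / 6 - (1 - v) ^ 2 / 2) + pp (u - v).

Lemma is_derive_green (u v : R) : is_derive (fun u => green u v) u (green1 u v).
Proof.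
unfold green. apply is_derive_ext with (fun u =>
  (- u ^ 4 / 24 + (1 / 6 - (1 - v) ^ 2 / 2) * u ^ 2 / 2
   + 1 / 120 - 1 / 36 + (1 - v) ^ 2 / 12 - (1 - v) ^ 4 / 24)
  + (0 * pp (u - v) ^ 2 + / 6 * pp (u - v) ^ 3 + 0 * pp (u - v) ^ 4)).
{ intro t; simpl; field. }
evar_last.
- apply @is_derive_plus; [|apply is_derive_pp_comb]. auto_derive; [exact I|reflexivity].
- unfold plus; simpl; unfold green1; field.
Qed.

Lemma is_derive_green1 (u v : R) : is_derive (fun u => green1 u v) u (green2 u v).
Proof.
unfold green1. apply is_derive_ext with (fun u =>
  (- u ^ 3 / 6 + (1 / 6 - (1 - v) ^ 2 / 2) * u)
  + (/ 2 * pp (u - v) ^ 2 + 0 * pp (u - v) ^ 3 + 0 * pp (u - v) ^ 4)).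
{ intro t; simpl; field. }
evar_last.
- apply @is_derive_plus; [|apply is_derive_pp_comb]. auto_derive; [exact I|reflexivity].
- unfold plus; simpl; unfold green2; field.
Qed.

Lemma continuous_green (u v : R) : continuous (fun u => green u v) u.
Proof. eapply continuous_of_derive, is_derive_green. Qed.

Lemma is_RInt_green (v : R) : 0 <= v <= 1 -> is_RInt (fun u => green u v) 0 1 0.
Proof.
intro Hv. apply (is_RInt_primitive (fun u =>
  (- u ^ 5 / 120 + (1 / 6 - (1 - v) ^ 2 / 2) * u ^ 3 / 6
   + (1 / 120 - 1 / 36 + (1 - v) ^ 2 / 12 - (1 - v) ^ 4 / 24) * u)
  + (0 * pp (u - v) ^ 2 + 0 * pp (u - v) ^ 3 + / 24 * pp (u - v) ^ 4))).
- intro u. evar_last.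
  + apply @is_derive_plus; [|apply is_derive_pp_comb]. auto_derive; [exact I|reflexivity].
  + unfold plus; simpl; unfold green; field.
- intro u. apply continuous_green.
- rewrite (pp_neg (0 - v)), (pp_pos (1 - v)) by lra. field.
Qed.

Lemma psi2_lip (u v x : R) : 0 <= u <= 1 -> 0 <= v <= 1 ->
  Rabs (psi2 u x - psi2 v x) <= 2 * Rabs (u - v).
Proof.
intros Hu Hv. unfold psi2.
replace (_ - _) with ((1 - u + (1 - v)) / 2 * (v - u) + (pp (x - v) - pp (x - u))) by field.
eapply Rle_trans; [apply Rabs_triang|].
assert (A := pp_lip (x - v) (x - u)).
replace (x - v - (x - u)) with (u - v) in A by ring.
rewrite Rabs_mult, (Rabs_minus_sym v u), Rabs_right by lra.
assert (0 <= Rabs (u - v)) by apply Rabs_pos. nra.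
Qed.

Lemma psi2_bound (u x : R) : 0 <= u <= 1 -> 0 <= x <= 1 -> Rabs (psi2 u x) <= 2.
Proof.
intros Hu Hx. unfold psi2, pp, Rmax. apply Rabs_le. destruct Rle_dec; split; nra.
Qed.

(** The squared distance of [psi2 u] and [psi2 v] in [L^2]. *)
Lemma green_dist (u v : R) : 0 <= u <= 1 -> 0 <= v <= 1 ->
  green u u - 2 * green u v + green v v <= 4 * (u - v) ^ 2.
Proof.
intros Hu Hv.
assert (A : is_RInt (fun x => (psi2 u x - psi2 v x) ^ 2) 0 1 (green u u - 2 * green u v + green v v)).
{ apply is_RInt_ext with (fun x => (psi2 u x * psi2 u x - 2 * (psi2 u x * psi2 v x)) + psi2 v x * psi2 v x).
  { intros; eqR; ring. }
  apply @is_RInt_plus; [apply @is_RInt_minus|].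
  - now apply is_RInt_psi2_psi2.
  - apply (is_RInt_scal (fun x => psi2 u x * psi2 v x) 0 1 2). now apply is_RInt_psi2_psi2.
  - now apply is_RInt_psi2_psi2. }
assert (B : is_RInt (fun _ => 4 * (u - v) ^ 2) 0 1 (4 * (u - v) ^ 2)).
{ apply (is_RInt_primitive (fun x => 4 * (u - v) ^ 2 * x)).
  - intro x. auto_derive; [exact I|ring].
  - intro x. apply continuous_const.
  - ring. }
apply (is_RInt_le _ _ _ _ _ _ Rle_0_1 A B).
intros x Hx. assert (L := psi2_lip u v x Hu Hv).
rewrite <- (pow2_abs (psi2 u x - psi2 v x)), <- (pow2_abs (u - v)).
assert (0 <= Rabs (psi2 u x - psi2 v x)) by apply Rabs_pos. nra.
Qed.

Lemma green_lip (u v w : R) : 0 <= u <= 1 -> 0 <= v <= 1 -> 0 <= w <= 1 ->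
  Rabs (green u w - green v w) <= 4 * Rabs (u - v).
Proof.
intros Hu Hv Hw.
assert (A : is_RInt (fun x => (psi2 u x - psi2 v x) * psi2 w x) 0 1 (green u w - green v w)).
{ apply is_RInt_ext with (fun x => psi2 u x * psi2 w x - psi2 v x * psi2 w x).
  { intros; eqR; ring. }
  apply @is_RInt_minus; apply is_RInt_psi2_psi2; assumption. }
rewrite <- (is_RInt_unique _ _ _ _ A).
replace (4 * Rabs (u - v)) with ((1 - 0) * (4 * Rabs (u - v))) by ring.
apply abs_RInt_le_const; [lra|now exists (green u w - green v w)|].
intros x Hx. rewrite Rabs_mult.
assert (L := psi2_lip u v x Hu Hv). assert (B := psi2_bound w x Hw Hx).
assert (0 <= Rabs (psi2 u x - psi2 v x)) by apply Rabs_pos.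
assert (0 <= Rabs (psi2 w x)) by apply Rabs_pos. nra.
Qed.

(** * The energy of a probability measure *)

(** The potential of the measure [l], and its energy. *)
Definition pot (l : list (R * R)) (x : R) : R := lsum (green x) l.
Definition energy (l : list (R * R)) : R := lsum (pot l) l.

(** The points, not the weights, lie in [[0, 1]]. *)
Definition in01 (l : list (R * R)) : Prop := forall p, In p l -> 0 <= snd p <= 1.

Lemma is_RInt_energy (l : list (R * R)) : in01 l ->
  is_RInt (fun x => lsum (fun y => psi2 y x) l ^ 2) 0 1 (energy l).
Proof.
intro Hl.
apply is_RInt_ext with (fun x => lsum (fun u => lsum (fun v => psi2 u x * psi2 v x) l) l).
- intros x _. eqR.
  rewrite (lsum_ext _ (fun u => lsum (fun v => psi2 v x) l * psi2 u x)).
  + rewrite lsum_scal. simpl; ring.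
  + intros p _. rewrite lsum_scal. ring.
- unfold energy. apply (is_RInt_lsum (fun u x => lsum (fun v => psi2 u x * psi2 v x) l)).
  intros p Hp. unfold pot.
  apply (is_RInt_lsum (fun v x => psi2 (snd p) x * psi2 v x) (green (snd p))).
  intros q Hq. apply is_RInt_psi2_psi2; auto.
Qed.

Lemma energy_ge0 (l : list (R * R)) : in01 l -> 0 <= energy l.
Proof.
intro Hl. apply (is_RInt_le (fun _ => 0) (fun x => lsum (fun y => psi2 y x) l ^ 2) 0 1).
- lra.
- apply (is_RInt_primitive (fun _ => 0)).
  + intro x. apply (is_derive_const 0).
  + intro x. apply continuous_const.
  + ring.
- now apply is_RInt_energy.
- intros. apply pow2_ge_0.
Qed.

Lemma continuous_lsum (F : R -> R -> R) (x : R) (l : list (R * R)) :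
  (forall y, continuous (F y) x) -> continuous (fun x => lsum (fun y => F y x) l) x.
Proof.
intro Hc. induction l as [|p l IH]; simpl.
- apply continuous_const.
- apply (continuous_plus (fun x => fst p * F (snd p) x)
    (fun x => lsum (fun y => F y x) l)); [|exact IH].
  apply (continuous_mult (fun _ => fst p) (F (snd p))); [apply continuous_const|apply Hc].
Qed.

(** The Legendre polynomial of degree 2 minimises the [L^2] norm among the
    quadratic polynomials with the same leading coefficient. *)
Lemma quadratic_L2_lower (al be u v : R) : u <= v ->
  (v - u) ^ 5 / 720 <= RInt (fun x => (x ^ 2 / 2 + al * x + be) ^ 2) u v.
Proof.
intro Huv.
rewrite (is_RInt_unique _ u v
  ((v - u) ^ 5 / 720 + (v - u) ^ 3 / 12 * ((u + v) / 2 + al) ^ 2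
   + (v - u) * ((u ^ 2 + u * v + v ^ 2) / 6 + al * (u + v) / 2 + be) ^ 2)).
- assert (0 <= (v - u) ^ 3) by (apply pow_le; lra).
  assert (0 <= ((u + v) / 2 + al) ^ 2) by apply pow2_ge_0.
  assert (0 <= ((u ^ 2 + u * v + v ^ 2) / 6 + al * (u + v) / 2 + be) ^ 2) by apply pow2_ge_0.
  assert (0 <= (v - u) ^ 3 / 12 * ((u + v) / 2 + al) ^ 2)
    by (apply Rmult_le_pos; lra).
  assert (0 <= (v - u) * ((u ^ 2 + u * v + v ^ 2) / 6 + al * (u + v) / 2 + be) ^ 2)
    by (apply Rmult_le_pos; lra).
  lra.
- apply (is_RInt_primitive (fun x => x ^ 5 / 20 + al * x ^ 4 / 4 + (al ^ 2 + be) * x ^ 3 / 3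
    + al * be * x ^ 2 + be ^ 2 * x)).
  + intro x. auto_derive; [exact I|simpl; field].
  + intro x. eapply continuous_of_derive. auto_derive; [exact I|reflexivity].
  + field.
Qed.

(** Convexity of [h^5]. *)
Lemma pow5_split (h k m : R) : 0 <= h -> 0 <= k -> 0 < m ->
  (h + k) ^ 5 / (m + 1) ^ 4 <= h ^ 5 + k ^ 5 / m ^ 4.
Proof.
intros Hh Hk Hm.
set (t := (h + k) / (m + 1)). set (r := k / m).
assert (Ht : 0 <= t) by (apply Rdiv_le_0_compat; lra).
assert (Hr : 0 <= r) by (apply Rdiv_le_0_compat; lra).
assert (T : forall s, 0 <= s -> t ^ 5 + 5 * t ^ 4 * (s - t) <= s ^ 5).
{ intros s Hs.
  assert (0 <= (s - t) ^ 2 * (s ^ 3 + 2 * s ^ 2 * t + 3 * s * t ^ 2 + 4 * t ^ 3)).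
  { apply Rmult_le_pos; [apply pow2_ge_0|].
    assert (0 <= s * t) by nra. assert (0 <= s ^ 3) by (apply pow_le; lra).
    assert (0 <= t ^ 3) by (apply pow_le; lra). simpl in *. nra. }
  replace (s ^ 5) with (t ^ 5 + 5 * t ^ 4 * (s - t)
    + (s - t) ^ 2 * (s ^ 3 + 2 * s ^ 2 * t + 3 * s * t ^ 2 + 4 * t ^ 3)) by ring.
  lra. }
assert (A := T h Hh). assert (B := T r Hr).
replace ((h + k) ^ 5 / (m + 1) ^ 4) with ((m + 1) * t ^ 5) by (unfold t; field; lra).
replace (k ^ 5 / m ^ 4) with (m * r ^ 5) by (unfold r; field; lra).
assert (C : h - t + m * (r - t) = 0) by (unfold t, r; field; lra).
assert (D : 5 * t ^ 4 * (h - t + m * (r - t)) = 0) by (rewrite C; ring).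
apply (Rmult_le_compat_l m) in B; lra.
Qed.

(** The points, not the weights, are in increasing order. *)
Definition points_sorted := StronglySorted (fun p q : R * R => snd p <= snd q).

(** [l] lists the knots in [[u, 1]] of a quadratic spline, which are split off one
    by one from the left. *)
Lemma spline_L2_lower (l : list (R * R)) : forall (al be u : R), u <= 1 ->
  points_sorted l -> (forall p, In p l -> u <= snd p <= 1) ->
  (1 - u) ^ 5 / (720 * (INR (length l) + 1) ^ 4) <=
  RInt (fun x => (x ^ 2 / 2 + al * x + be - lsum (fun y => pp (x - y)) l) ^ 2) u 1.
Proof.
assert (Ct : forall al be l x, continuous (fun x =>
  (x ^ 2 / 2 + al * x + be - lsum (fun y => pp (x - y)) l) ^ 2) x).
{ intros al be l' x.
  apply (continuous_comp (fun x => x ^ 2 / 2 + al * x + be - lsum (fun y => pp (x - y)) l')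
    (fun x => x ^ 2)).
  - apply (continuous_minus (fun x => x ^ 2 / 2 + al * x + be)
      (fun x => lsum (fun y => pp (x - y)) l')).
    + eapply continuous_of_derive. auto_derive; [exact I|reflexivity].
    + apply (continuous_lsum (fun y x => pp (x - y))). intro; apply continuous_pp_r.
  - eapply continuous_of_derive. auto_derive; [exact I|reflexivity]. }
assert (Ci : forall al be l u v, ex_RInt (fun x =>
  (x ^ 2 / 2 + al * x + be - lsum (fun y => pp (x - y)) l) ^ 2) u v).
{ intros. apply (@ex_RInt_continuous R_CompleteNormedModule). intros; apply Ct. }
induction l as [|[b y] l IH]; intros al be u Hu Hs Hl.
- simpl length. simpl INR.
  rewrite (RInt_ext _ (fun x => (x ^ 2 / 2 + al * x + be) ^ 2)).
  + eapply Rle_trans; [|now apply quadratic_L2_lower].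
    right. field.
  + intros x _. eqR. cbn [lsum]. ring.
- assert (Hy : u <= y <= 1) by apply (Hl (b, y) (or_introl eq_refl)).
  inversion Hs as [|? ? Hs' Hf]; subst.
  assert (Hl' : forall p, In p l -> y <= snd p <= 1).
  { intros p Hp. split; [|apply (Hl p (or_intror Hp))].
    rewrite Forall_forall in Hf. apply (Hf p Hp). }
  rewrite <- (RInt_Chasles _ u y 1) by apply Ci.
  rewrite (RInt_ext _ (fun x => (x ^ 2 / 2 + al * x + be) ^ 2) u y).
  2:{ intros x Hx. rewrite Rmin_left, Rmax_right in Hx by lra. eqR.
      rewrite (lsum_ext _ (fun _ => 0 * 0)).
      - rewrite lsum_scal. ring.
      - intros p [<-|Hp]; simpl snd; rewrite pp_neg; try lra.
        destruct (Hl' p Hp). lra. }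
  rewrite (RInt_ext _ (fun x => (x ^ 2 / 2 + (al - b) * x + (be + b * y)
     - lsum (fun y => pp (x - y)) l) ^ 2) y 1).
  2:{ intros x Hx. rewrite Rmin_left, Rmax_right in Hx by lra. eqR.
      cbn [lsum fst snd]. rewrite (pp_pos (x - y)) by lra. ring. }
  assert (A := quadratic_L2_lower al be u y (proj1 Hy)).
  assert (B := IH (al - b) (be + b * y) y (proj2 Hy) Hs' Hl').
  assert (0 < INR (length l) + 1) by (assert (0 <= INR (length l)) by apply pos_INR; lra).
  assert (C := pow5_split (y - u) (1 - y) (INR (length l) + 1) ltac:(lra) ltac:(lra) ltac:(lra)).
  replace (y - u + (1 - y)) with (1 - u) in C by ring.
  cbn [length]. rewrite S_INR.
  match goal with |- ?a <= _ =>
    replace a with ((1 - u) ^ 5 / (INR (length l) + 1 + 1) ^ 4 / 720) by (field; lra) end.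
  match type of B with ?a <= _ =>
    replace a with ((1 - y) ^ 5 / (INR (length l) + 1) ^ 4 / 720) in B by (field; lra) end.
  match goal with |- _ <= plus ?x ?y => change (plus x y) with (x + y) end.
  lra.
Qed.

Lemma sort_exists (l : list (R * R)) : exists l', Permutation l l' /\ points_sorted l'.
Proof.
assert (Ins : forall p l, points_sorted l -> exists l', Permutation (p :: l) l' /\ points_sorted l').
{ intros p. clear l. induction l as [|q l IH]; intro Hs.
  - exists (p :: nil). split; [reflexivity|]. repeat constructor.
  - destruct (Rle_dec (snd p) (snd q)) as [Hpq|Hpq].
    + exists (p :: q :: l). split; [reflexivity|]. constructor; [exact Hs|].
      inversion Hs as [|? ? _ Hf]; subst. constructor; [exact Hpq|].
      eapply Forall_impl; [|exact Hf]. simpl; intros; lra.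
    + inversion Hs as [|? ? Hs' Hf]; subst.
      destruct (IH Hs') as [l' [Hp Hl']].
      exists (q :: l'). split.
      * etransitivity; [apply perm_swap|]. now constructor.
      * constructor; [exact Hl'|].
        rewrite Forall_forall in *. intros r Hr.
        apply (Permutation_in r (Permutation_sym Hp)) in Hr.
        destruct Hr as [<-|Hr]; [lra|now apply Hf]. }
induction l as [|p l IH].
- exists nil. split; [reflexivity|constructor].
- destruct IH as [l' [Hp Hs]]. destruct (Ins p l' Hs) as [l'' [Hp' Hs']].
  exists l''. split; [|exact Hs']. etransitivity; [|exact Hp']. now constructor.
Qed.

(** Two lists represent the same measure. *)
Definition same_measure (l l' : list (R * R)) : Prop := forall F, lsum F l = lsum F l'.

Lemma energy_same (l l' : list (R * R)) : same_measure l l' -> energy l = energy l'.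
Proof.
intro E. unfold energy. rewrite E. apply lsum_ext. intros p _. apply E.
Qed.

(** [sum b = 1] makes the integrand of the energy a quadratic spline with
    leading coefficient 1/2 in each of the intervals cut out by the points. *)
Lemma energy_lower (l : list (R * R)) : in01 l -> lsum (fun _ => 1) l = 1 ->
  1 / (720 * (INR (length l) + 1) ^ 4) <= energy l.
Proof.
intros Hl Hm. destruct (sort_exists l) as [l' [Hp Hs]].
assert (E : same_measure l l') by (intro F; now apply lsum_perm).
rewrite (energy_same l l' E), (Permutation_length Hp).
assert (Hl' : in01 l').
{ intros p Hin. apply Hl. eapply Permutation_in; [symmetry; exact Hp|exact Hin]. }
rewrite E in Hm.
rewrite <- (is_RInt_unique _ _ _ _ (is_RInt_energy l' Hl')).
set (c := lsum (fun y => - (1 / 6) + (1 - y) ^ 2 / 2) l').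
assert (A := spline_L2_lower l' 0 c 0 Rle_0_1 Hs Hl').
rewrite (RInt_ext _ (fun x => (x ^ 2 / 2 + 0 * x + c
  - lsum (fun y => pp (x - y)) l') ^ 2)).
- eapply Rle_trans; [|exact A]. right.
  rewrite Rminus_0_r, pow1. reflexivity.
- intros x _. eqR. f_equal. unfold c.
  replace (x ^ 2 / 2) with (x ^ 2 / 2 * lsum (fun _ => 1) l') by (rewrite Hm; ring).
  rewrite <- (Rmult_1_r (lsum (fun y => - (1 / 6) + _) l')).
  rewrite (lsum_ext _ (fun y => x ^ 2 / 2 * 1
    + (1 * (- (1 / 6) + (1 - y) ^ 2 / 2) + (-1) * pp (x - y)))).
  + rewrite lsum_plus, lsum_scal, lsum_lin. ring.
  + intros p _. unfold psi2. field.
Qed.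

(** * Compactness of the probability measures with a given number of points *)

(** Probability measures on [[0, 1]]; zero weights and repeated points are
    allowed. *)
Definition valid (l : list (R * R)) : Prop :=
  (forall p, In p l -> 0 <= fst p /\ 0 <= snd p <= 1) /\ lsum (fun _ => 1) l = 1.

(** The functional whose minimisers over measures with a given number of points
    yield the lower bound for the integral of [K]. *)
Definition Theta (K : R -> R) (l : list (R * R)) : R := energy l / 2 + lsum K l.

Lemma valid_in01 (l : list (R * R)) : valid l -> in01 l.
Proof. intros [Hv _] p Hp. apply (Hv p Hp). Qed.

Lemma valid_weight_le (l : list (R * R)) (p : R * R) : valid l -> In p l -> fst p <= 1.
Proof.
intros [Hv Hm] Hp. destruct (in_split p l Hp) as [l1 [l2 E]].
assert (A : lsum (fun _ => 1) l = lsum (fun _ => 1) (p :: l1 ++ l2)).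
{ apply lsum_perm. rewrite E. symmetry. apply Permutation_middle. }
assert (B : 0 <= lsum (fun _ => 1) (l1 ++ l2)).
{ apply lsum_nonneg. intros q Hq. rewrite Rmult_1_r. apply Hv. rewrite E.
  apply in_app_iff in Hq. apply in_app_iff. simpl. tauto. }
cbn [lsum] in A. lra.
Qed.

(** Entrywise convergence of a sequence of lists. *)
Fixpoint list_lim (u : nat -> list (R * R)) (l : list (R * R)) : Prop :=
  match l with
  | nil => forall n, u n = nil
  | p :: l' => exists (b y : nat -> R) (v : nat -> list (R * R)),
      (forall n, u n = (b n, y n) :: v n) /\
      is_lim_seq b (fst p) /\ is_lim_seq y (snd p) /\ list_lim v l'
  end.

Lemma is_lim_seq_extract (u : nat -> R) (x : R) (phi : nat -> nat) :
  (forall n, (n <= phi n)%nat) -> is_lim_seq u x -> is_lim_seq (fun n => u (phi n)) x.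
Proof.
intros Hphi Hu. apply (is_lim_seq_subseq u x phi); [|exact Hu].
intros P [N HN]. exists N. intros n Hn. apply HN. specialize (Hphi n). lia.
Qed.

Lemma list_lim_extract (l : list (R * R)) : forall u (phi : nat -> nat),
  (forall n, (n <= phi n)%nat) -> list_lim u l -> list_lim (fun n => u (phi n)) l.
Proof.
induction l as [|p l IH]; intros u phi Hphi Hu; simpl in *.
- intro; apply Hu.
- destruct Hu as [b [y [v [Hu [Hb [Hy Hv]]]]]].
  exists (fun n => b (phi n)), (fun n => y (phi n)), (fun n => v (phi n)).
  split; [intro; apply Hu|].
  split; [now apply is_lim_seq_extract|].
  split; [now apply is_lim_seq_extract|]. now apply IH.
Qed.

Lemma list_lim_length (l : list (R * R)) : forall u, list_lim u l ->
  forall n, length (u n) = length l.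
Proof.
induction l as [|p l IH]; intros u Hu n; simpl in *.
- now rewrite Hu.
- destruct Hu as [b [y [v [Hu [_ [_ Hv]]]]]]. rewrite Hu. simpl. now rewrite (IH v Hv n).
Qed.

Lemma is_lim_seq_Icc (u : nat -> R) (x a b : R) :
  (forall n, a <= u n <= b) -> is_lim_seq u x -> a <= x <= b.
Proof.
intros Hu Hx. split.
- apply (is_lim_seq_le (fun _ => a) u a x); [apply Hu|apply is_lim_seq_const|exact Hx].
- apply (is_lim_seq_le u (fun _ => b) x b); [apply Hu|exact Hx|apply is_lim_seq_const].
Qed.

(** The extraction need not be increasing: [n <= phi n] is enough for limits. *)
Lemma bolzano_weierstrass01 (u : nat -> R) : (forall n, 0 <= u n <= 1) ->
  exists (phi : nat -> nat) (x : R), (forall n, (n <= phi n)%nat) /\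
    is_lim_seq (fun n => u (phi n)) x.
Proof.
intro Hu.
destruct (Bolzano_Weierstrass u _ (compact_P3 0 1) Hu) as [x Hx].
assert (A : forall n : nat, exists p, (n <= p)%nat /\ Rabs (u p - x) < / (INR n + 1)).
{ intro n. assert (Hn : 0 < / (INR n + 1)).
  { apply Rinv_0_lt_compat. assert (0 <= INR n) by apply pos_INR. lra. }
  destruct (Hx (fun z => Rabs (z - x) < / (INR n + 1)) n) as [p [Hp Hd]].
  - exists (mkposreal _ Hn). intros z Hz. exact Hz.
  - now exists p. }
exists (fun n => proj1_sig (constructive_indefinite_description _ (A n))), x.
split.
- intro n. destruct (constructive_indefinite_description _ (A n)) as [p [Hp Hd]]. exact Hp.
- apply is_lim_seq_spec. intros eps.
  destruct (INR_unbounded (/ eps)) as [N HN].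
  exists N. intros n Hn.
  destruct (constructive_indefinite_description _ (A n)) as [p [Hp Hd]]. simpl.
  eapply Rlt_le_trans; [exact Hd|].
  assert (0 < eps) by apply cond_pos. assert (INR N <= INR n) by now apply le_INR.
  assert (0 < / eps) by now apply Rinv_0_lt_compat.
  rewrite <- (Rinv_inv eps). apply Rinv_le_contravar; lra.
Qed.

Lemma list_compact (m : nat) : forall u : nat -> list (R * R),
  (forall n, length (u n) = m) ->
  (forall n p, In p (u n) -> 0 <= fst p <= 1 /\ 0 <= snd p <= 1) ->
  exists (phi : nat -> nat) (l : list (R * R)), (forall n, (n <= phi n)%nat) /\
    list_lim (fun n => u (phi n)) l.
Proof.
induction m as [|m IH]; intros u Hm Hu.
- exists (fun n => n), nil. split; [intro; lia|].
  intro n. apply length_zero_iff_nil, Hm.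
- set (h := fun n => hd (0, 0) (u n)). set (v := fun n => tl (u n)).
  assert (E : forall n, u n = h n :: v n).
  { intro n. unfold h, v. specialize (Hm n). destruct (u n); [discriminate|reflexivity]. }
  destruct (IH v) as [phi [l [Hphi Hl]]].
  + intro n. specialize (Hm n). rewrite E in Hm. simpl in Hm. lia.
  + intros n p Hp. apply (Hu n). rewrite E. now right.
  + assert (Hh : forall n, 0 <= fst (h n) <= 1 /\ 0 <= snd (h n) <= 1).
    { intro n. apply (Hu n). rewrite E. now left. }
    destruct (bolzano_weierstrass01 (fun n => fst (h (phi n)))) as [psi [b [Hpsi Hb]]].
    { intro n. apply Hh. }
    destruct (bolzano_weierstrass01 (fun n => snd (h (phi (psi n))))) as [chi [y [Hchi Hy]]].
    { intro n. apply Hh. }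
    exists (fun n => phi (psi (chi n))), ((b, y) :: l). split.
    * intro n. specialize (Hchi n). specialize (Hpsi (chi n)).
      specialize (Hphi (psi (chi n))). lia.
    * exists (fun n => fst (h (phi (psi (chi n))))), (fun n => snd (h (phi (psi (chi n))))),
        (fun n => v (phi (psi (chi n)))).
      split; [|split; [|split]].
      -- intro n. rewrite E. now destruct (h _).
      -- apply (is_lim_seq_extract (fun n => fst (h (phi (psi n))))); assumption.
      -- exact Hy.
      -- apply (list_lim_extract l (fun n => v (phi n)) (fun n => psi (chi n))).
         ++ intro n. specialize (Hchi n). specialize (Hpsi (chi n)). lia.
         ++ exact Hl.
Qed.

Lemma lsum_lim (F : nat -> R -> R) (G : R -> R) (l : list (R * R)) : forall u,
  list_lim u l -> (forall n, in01 (u n)) ->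
  (forall (y : nat -> R) (z : R), (forall n, 0 <= y n <= 1) -> is_lim_seq y z ->
     is_lim_seq (fun n => F n (y n)) (G z)) ->
  is_lim_seq (fun n => lsum (F n) (u n)) (lsum G l).
Proof.
induction l as [|p l IH]; intros u Hu H01 HF; simpl in *.
- apply is_lim_seq_ext with (fun _ => 0); [|apply is_lim_seq_const].
  intro n. now rewrite Hu.
- destruct Hu as [b [y [v [Hu [Hb [Hy Hv]]]]]].
  apply is_lim_seq_ext with (fun n => b n * F n (y n) + lsum (F n) (v n)).
  { intro n. now rewrite Hu. }
  apply is_lim_seq_plus'.
  + apply is_lim_seq_mult'; [exact Hb|]. apply HF; [|exact Hy].
    intro n. apply (H01 n (b n, y n)). rewrite Hu. now left.
  + apply IH; [exact Hv| |exact HF].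
    intros n q Hq. apply (H01 n). rewrite Hu. now right.
Qed.

Lemma green_lim (x y : nat -> R) (a b : R) :
  (forall n, 0 <= x n <= 1) -> (forall n, 0 <= y n <= 1) ->
  is_lim_seq x a -> is_lim_seq y b -> is_lim_seq (fun n => green (x n) (y n)) (green a b).
Proof.
intros Hx Hy La Lb.
assert (Ha := is_lim_seq_Icc _ _ _ _ Hx La). assert (Hb := is_lim_seq_Icc _ _ _ _ Hy Lb).
assert (Z : forall (u : nat -> R) (c : R), is_lim_seq u c ->
  is_lim_seq (fun n => 4 * Rabs (u n - c)) 0).
{ intros u c Hu. evar_last.
  - apply (is_lim_seq_scal_l _ 4). apply (is_lim_seq_abs _ (c - c)).
    apply is_lim_seq_minus'; [exact Hu|apply is_lim_seq_const].
  - simpl. rewrite Rminus_diag, Rabs_R0. now rewrite Rmult_0_r. }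
assert (S := is_lim_seq_plus' _ _ _ _ (Z x a La) (Z y b Lb)).
rewrite Rplus_0_r in S.
assert (W : is_lim_seq (fun n => green (x n) (y n) - green a b) 0).
2:{ assert (V := is_lim_seq_plus' _ _ _ _ W (is_lim_seq_const (green a b))).
    rewrite Rplus_0_l in V. eapply is_lim_seq_ext; [|exact V]. intro; simpl; ring. }
apply is_lim_seq_abs_0.
apply (is_lim_seq_le_le (fun _ => 0) _ (fun n => 4 * Rabs (x n - a) + 4 * Rabs (y n - b)));
  [|apply is_lim_seq_const|exact S].
intro n. split; [apply Rabs_pos|].
replace (green (x n) (y n) - green a b)
  with ((green (x n) (y n) - green a (y n)) + (green (y n) a - green b a))
  by (rewrite (green_sym (y n) a), (green_sym b a); ring).
eapply Rle_trans; [apply Rabs_triang|].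
apply Rplus_le_compat; apply green_lip; auto.
Qed.

Lemma Theta_lim (K : R -> R) (l : list (R * R)) (u : nat -> list (R * R)) :
  (forall x, continuous K x) -> list_lim u l -> (forall n, in01 (u n)) ->
  is_lim_seq (fun n => Theta K (u n)) (Theta K l).
Proof.
intros HK Hu H01. unfold Theta, energy. apply is_lim_seq_plus'.
- apply is_lim_seq_div'; [|apply is_lim_seq_const|lra].
  apply lsum_lim; [exact Hu|exact H01|].
  intros y z Hy Lz. unfold pot. apply lsum_lim; [exact Hu|exact H01|].
  intros w t Hw Lt. now apply green_lim.
- apply lsum_lim; [exact Hu|exact H01|].
  intros y z Hy Lz. apply is_lim_seq_continuous; [|exact Lz].
  apply continuity_pt_filterlim, HK.
Qed.

Lemma valid_lim (l : list (R * R)) (u : nat -> list (R * R)) :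
  list_lim u l -> (forall n, valid (u n)) -> valid l.
Proof.
intros Hu Hv. split.
- assert (A : forall n p, In p (u n) -> 0 <= fst p /\ 0 <= snd p <= 1)
    by (intro n; apply (Hv n)). clear Hv.
  revert u Hu A. induction l as [|q l IH]; intros u Hu A p Hp; [destruct Hp|].
  destruct Hu as [b [y [v [Hu [Hb [Hy Hv]]]]]].
  destruct Hp as [<-|Hp].
  + assert (B : forall n, 0 <= b n /\ 0 <= y n <= 1).
    { intro n. apply (A n (b n, y n)). rewrite Hu. now left. }
    split.
    * apply (is_lim_seq_le (fun _ => 0) b 0 (fst q)); [apply B|apply is_lim_seq_const|exact Hb].
    * apply (is_lim_seq_Icc y); [apply B|exact Hy].
  + apply (IH v Hv); [|exact Hp]. intros n r Hr. apply (A n). rewrite Hu. now right.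
- assert (L : is_lim_seq (fun n => lsum (fun _ => 1) (u n)) (lsum (fun _ => 1) l)).
  { apply (lsum_lim (fun _ _ => 1)); [exact Hu|intro; now apply valid_in01|].
    intros; apply is_lim_seq_const. }
  apply (is_lim_seq_ext _ (fun _ => 1)) in L; [|intro n; apply (Hv n)].
  apply is_lim_seq_unique in L. rewrite Lim_seq_const in L. now injection L.
Qed.

Lemma Theta_ge0 (K : R -> R) (l : list (R * R)) :
  (forall x, 0 <= x <= 1 -> 0 <= K x) -> valid l -> 0 <= Theta K l.
Proof.
intros HK Hv. unfold Theta.
assert (A := energy_ge0 l (valid_in01 l Hv)).
assert (0 <= lsum K l).
{ apply lsum_nonneg. intros p Hp. destruct Hv as [Hv _]. destruct (Hv p Hp).
  apply Rmult_le_pos; auto. }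
lra.
Qed.

Lemma Theta_min_exists (K : R -> R) (m : nat) :
  (forall x, 0 <= x <= 1 -> 0 <= K x) -> (forall x, continuous K x) -> (1 <= m)%nat ->
  exists l, valid l /\ length l = m /\
    forall l', valid l' -> length l' = m -> Theta K l <= Theta K l'.
Proof.
intros HK HKc Hm.
destruct (completeness (fun x => exists l, valid l /\ length l = m /\ x = - Theta K l))
  as [M [HM1 HM2]].
- exists 0. intros x [l [Hv [_ ->]]]. assert (A := Theta_ge0 K l HK Hv). lra.
- set (l := (1, 0) :: repeat (0, 0) (m - 1)).
  exists (- Theta K l), l. split; [split|split].
  + intros p [<-|Hp]; simpl; [lra|]. apply repeat_spec in Hp. subst p; simpl; lra.
  + unfold l. cbn [lsum fst snd]. replace (lsum _ _) with 0; [ring|].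
    induction (m - 1)%nat as [|k IH]; simpl; [reflexivity|]. rewrite <- IH. ring.
  + unfold l. simpl. rewrite repeat_length. lia.
  + reflexivity.
- assert (A : forall n : nat, exists l, valid l /\ length l = m /\
    Theta K l <= - M + / (INR n + 1)).
  { intro n. apply NNPP. intro Hn.
    assert (B : 0 < / (INR n + 1)).
    { apply Rinv_0_lt_compat. assert (0 <= INR n) by apply pos_INR. lra. }
    assert (C : M <= M - / (INR n + 1)); [|lra].
    apply HM2. intros x [l [Hv [Hl ->]]].
    destruct (Rle_dec (Theta K l) (- M + / (INR n + 1))) as [Hle|Hle]; [|lra].
    exfalso. apply Hn. now exists l. }
  set (u := fun n => proj1_sig (constructive_indefinite_description _ (A n))).
  assert (Hu : forall n, valid (u n) /\ length (u n) = m /\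
    Theta K (u n) <= - M + / (INR n + 1)).
  { intro n. unfold u. now destruct (constructive_indefinite_description _ (A n)). }
  clearbody u.
  destruct (list_compact m u) as [phi [l [Hphi Hl]]].
  + intro n. apply Hu.
  + intros n p Hp. destruct (Hu n) as [Hv _]. destruct (proj1 Hv p Hp).
    assert (fst p <= 1) by now apply valid_weight_le with (u n). lra.
  + exists l. split; [|split].
    * apply (valid_lim l _ Hl). intro n. apply Hu.
    * rewrite <- (list_lim_length l _ Hl 0%nat). apply Hu.
    * intros l' Hv' Hl'. apply Rle_trans with (- M).
      2:{ assert (- Theta K l' <= M) by (apply HM1; now exists l'). lra. }
      assert (L : is_lim_seq (fun n => - M + / (INR n + 1)) (- M)).
      { replace (Finite (- M)) with (Finite (- M + 0)) by (f_equal; ring).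
        apply is_lim_seq_plus'; [apply is_lim_seq_const|].
        apply is_lim_seq_ext with (fun n => / INR (S n)).
        { intro n. now rewrite S_INR. }
        apply (is_lim_seq_incr_1 (fun n => / INR n)).
        apply (is_lim_seq_inv _ p_infty); [apply is_lim_seq_INR|easy]. }
      apply (is_lim_seq_le (fun n => Theta K (u (phi n))) (fun n => - M + / (INR n + 1))
        (Theta K l) (- M)); [|now apply Theta_lim; [| |intro; apply valid_in01, Hu]|exact L].
      intro n. destruct (Hu (phi n)) as [_ [_ B]]. eapply Rle_trans; [exact B|].
      apply Rplus_le_compat_l. apply Rinv_le_contravar.
      -- assert (0 <= INR n) by apply pos_INR. lra.
      -- apply Rplus_le_compat_r, le_INR, Hphi.
Qed.

(** * First-order conditions for a measure of minimal energy *)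

(** The measure [t l]. *)
Definition scale (t : R) (l : list (R * R)) : list (R * R) :=
  map (fun p => (t * fst p, snd p)) l.

Lemma energy_cons (b y : R) (l : list (R * R)) :
  energy ((b, y) :: l) = b ^ 2 * green y y + 2 * b * pot l y + energy l.
Proof.
unfold energy. cbn [lsum fst snd].
rewrite (lsum_ext (pot ((b, y) :: l)) (fun x => b * green y x + pot l x)).
- rewrite lsum_plus, lsum_scal.
  change (pot ((b, y) :: l) y) with (b * green y y + pot l y).
  change (lsum (green y) l) with (pot l y).
  change (lsum (fun x => pot l x) l) with (lsum (pot l) l). ring.
- intros p _. unfold pot. cbn [lsum fst snd]. now rewrite (green_sym (snd p) y).
Qed.

Lemma Theta_cons (K : R -> R) (b y : R) (l : list (R * R)) :
  Theta K ((b, y) :: l) = b ^ 2 * green y y / 2 + b * pot l y + b * K y + Theta K l.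
Proof. unfold Theta. rewrite energy_cons. cbn [lsum fst snd]. field. Qed.

Lemma energy_scale (t : R) (l : list (R * R)) : energy (scale t l) = t ^ 2 * energy l.
Proof.
unfold energy, scale. rewrite lsum_scale.
rewrite (lsum_ext _ (fun x => t * pot l x)).
- rewrite lsum_scal. ring.
- intros p _. unfold pot. apply lsum_scale.
Qed.

Lemma Theta_same (K : R -> R) (l l' : list (R * R)) :
  same_measure l l' -> Theta K l = Theta K l'.
Proof. intro E. unfold Theta. now rewrite (energy_same l l' E), E. Qed.

(** Mixing a measure with a point mass. *)
Lemma Theta_mix (K : R -> R) (t y : R) (l : list (R * R)) :
  Theta K ((t, y) :: scale (1 - t) l) - Theta K l =
  t * (K y + pot l y - (energy l + lsum K l))
  + t ^ 2 * ((energy l - 2 * pot l y + green y y) / 2).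
Proof.
rewrite Theta_cons. unfold Theta. rewrite energy_scale. unfold scale, pot.
rewrite !lsum_scale. field.
Qed.

(** A quadratic polynomial vanishing at 0 and nonnegative to the right of 0 has
    a nonnegative slope at 0. *)
Lemma first_order (A B d : R) : 0 < d ->
  (forall t, 0 < t <= d -> 0 <= t * A + t ^ 2 * B) -> 0 <= A.
Proof.
intros Hd HAB. destruct (Rle_dec 0 A) as [HA|HA]; [exact HA|exfalso].
set (t := Rmin d (- A / (2 * (Rabs B + 1)))).
assert (HB : 0 <= Rabs B) by apply Rabs_pos. assert (HB' := Rle_abs B).
assert (Ht0 : 0 < - A / (2 * (Rabs B + 1))) by (apply Rdiv_lt_0_compat; lra).
assert (Ht : 0 < t <= d).
{ split; [now apply Rmin_pos|apply Rmin_l]. }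
assert (Ht2 : t * (2 * (Rabs B + 1)) <= - A).
{ apply Rle_trans with (- A / (2 * (Rabs B + 1)) * (2 * (Rabs B + 1))).
  - apply Rmult_le_compat_r; [lra|apply Rmin_r].
  - right; field; lra. }
assert (P := HAB t Ht). nra.
Qed.

Lemma valid_same (l l' : list (R * R)) :
  same_measure l l' -> valid l ->
  (forall p, In p l' -> 0 <= fst p /\ 0 <= snd p <= 1) -> valid l'.
Proof. intros E [_ Hm] Hl'. split; [exact Hl'|]. now rewrite <- E. Qed.

(** If one more point does not improve a minimiser, [K + pot l] is bounded below
    by its mean value for [l]: mix [l] with the point mass at [y]. *)
Lemma potential_lower (K : R -> R) (l : list (R * R)) : valid l ->
  (forall l', valid l' -> length l' = S (length l) -> Theta K l <= Theta K l') ->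
  forall y, 0 <= y <= 1 -> energy l + lsum K l <= K y + pot l y.
Proof.
intros Hv Hmin y Hy.
cut (0 <= K y + pot l y - (energy l + lsum K l)); [lra|].
apply first_order with ((energy l - 2 * pot l y + green y y) / 2) 1; [lra|].
intros t Ht. rewrite <- Theta_mix.
cut (Theta K l <= Theta K ((t, y) :: scale (1 - t) l)); [lra|].
apply Hmin.
- destruct Hv as [Hv Hm]. split.
  + intros p [<-|Hp]; simpl; [lra|].
    apply in_map_iff in Hp. destruct Hp as [p' [<- Hp]]. destruct (Hv p' Hp). simpl.
    split; [|lra]. apply Rmult_le_pos; lra.
  + cbn [lsum fst snd]. unfold scale. rewrite lsum_scale, Hm. ring.
- simpl. unfold scale. now rewrite length_map.
Qed.

Lemma In_perm (p : R * R) (l : list (R * R)) :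
  In p l -> exists r, Permutation l (p :: r).
Proof.
intro Hp. destruct (in_split p l Hp) as [l1 [l2 ->]].
exists (l1 ++ l2). symmetry. apply Permutation_middle.
Qed.

Lemma perm_same (l l' : list (R * R)) : Permutation l l' -> same_measure l l'.
Proof. intros Hp F. now apply lsum_perm. Qed.

Lemma pot_same (l l' : list (R * R)) (x : R) : same_measure l l' -> pot l x = pot l' x.
Proof. intro E. apply E. Qed.

(** [K + pot l] is constant on the support of a minimiser: increase or decrease
    the weight of one point, and rescale. *)
Lemma potential_support (K : R -> R) (l : list (R * R)) (b y : R) : valid l ->
  (forall l', valid l' -> length l' = length l -> Theta K l <= Theta K l') ->
  In (b, y) l -> 0 < b -> K y + pot l y = energy l + lsum K l.
Proof.
intros Hv Hmin Hp Hb.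
assert (Hb1 : b <= 1) by apply (valid_weight_le l _ Hv Hp).
destruct (In_perm _ _ Hp) as [r Hr].
assert (T : forall t, - b <= t <= b ->
  0 <= t * (K y + pot l y - (energy l + lsum K l))
       + t ^ 2 * ((energy l - 2 * pot l y + green y y) / 2)).
{ intros t Ht. rewrite <- Theta_mix.
  cut (Theta K l <= Theta K ((t, y) :: scale (1 - t) l)); [lra|].
  assert (E : same_measure ((t, y) :: scale (1 - t) l)
    (((1 - t) * b + t, y) :: scale (1 - t) r)).
  { intro F. cbn [lsum fst snd]. unfold scale. rewrite !lsum_scale.
    rewrite (lsum_perm F _ _ Hr). cbn [lsum fst snd]. ring. }
  rewrite (Theta_same K _ _ E). apply Hmin.
  - split.
    + intros p [<-|Hin]; simpl.
      * split; [nra|]. apply (proj1 Hv (b, y) Hp).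
      * apply in_map_iff in Hin. destruct Hin as [p' [<- Hin]]. simpl.
        assert (Hin' : In p' l).
        { eapply Permutation_in; [symmetry; exact Hr|now right]. }
        destruct (proj1 Hv p' Hin'). split; [|lra]. apply Rmult_le_pos; lra.
    + rewrite <- E. cbn [lsum fst snd]. unfold scale. rewrite lsum_scale, (proj2 Hv). ring.
  - rewrite (Permutation_length Hr). simpl. unfold scale. now rewrite length_map. }
assert (A : 0 <= K y + pot l y - (energy l + lsum K l)).
{ eapply first_order; [exact Hb|]. intros t Ht. apply T. lra. }
assert (B : 0 <= - (K y + pot l y - (energy l + lsum K l))).
{ apply (first_order _ ((energy l - 2 * pot l y + green y y) / 2) b Hb).
  intros t Ht. eapply Rle_trans; [apply (T (- t)); lra|]. right. ring. }
lra.
Qed.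

(** Interior points of a minimiser are critical points of [K + pot l]: move one of
    them. *)
Lemma potential_critical (K : R -> R) (l : list (R * R)) (b y d : R) : valid l ->
  (forall l', valid l' -> length l' = length l -> Theta K l <= Theta K l') ->
  In (b, y) l -> 0 < b -> 0 < y < 1 ->
  is_derive (fun x => K x + pot l x) y d -> d = 0.
Proof.
intros Hv Hmin Hp Hb Hy Hd.
destruct (In_perm _ _ Hp) as [r Hr].
assert (E := perm_same _ _ Hr).
set (G := fun x => (K x + pot l x) + 2 * b * (x - y) ^ 2).
assert (HG : is_derive G y d).
{ unfold G. evar_last.
  - apply @is_derive_plus; [exact Hd|]. auto_derive; [exact I|reflexivity].
  - unfold plus; simpl. ring. }
assert (M : forall x, 0 < x -> x < 1 -> G y <= G x).
{ intros x Hx0 Hx1.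
  assert (A : Theta K l <= Theta K ((b, x) :: r)).
  { apply Hmin.
    - split.
      + intros p [<-|Hin]; simpl; [lra|]. apply Hv.
        eapply Permutation_in; [symmetry; exact Hr|now right].
      + transitivity (lsum (fun _ => 1) l); [now rewrite E|apply Hv].
    - now rewrite (Permutation_length Hr). }
  rewrite (Theta_same K _ _ E), !Theta_cons in A.
  unfold G. rewrite !(pot_same _ _ _ E). unfold pot in *. cbn [lsum fst snd].
  assert (B := green_dist x y ltac:(lra) ltac:(lra)).
  apply Rmult_le_reg_l with b; [exact Hb|].
  assert (C : b ^ 2 * (green x x - 2 * green x y + green y y) <= b ^ 2 * (4 * (x - y) ^ 2)).
  { apply Rmult_le_compat_l; [apply pow2_ge_0|exact B]. }
  rewrite Rminus_diag.
  set (X := (x - y) ^ 2) in *. nra. }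
assert (Hdl : derivable_pt_lim G y d) by now apply is_derive_Reals.
assert (Z := deriv_minimum G 0 1 y (exist _ d Hdl) (proj1 Hy) (proj2 Hy) M).
exact Z.
Qed.

(** A point of weight 0 could be dropped. *)
Lemma minimiser_positive (K : R -> R) (l : list (R * R)) (p : R * R) : valid l ->
  (forall l', valid l' -> S (length l') = length l -> Theta K l < Theta K l') ->
  In p l -> 0 < fst p.
Proof.
intros Hv Hlt Hp. destruct (proj1 Hv p Hp) as [H0 _].
destruct (Req_dec (fst p) 0) as [Hz|Hz]; [exfalso|lra].
destruct (In_perm _ _ Hp) as [r Hr].
assert (E : same_measure l r).
{ intro F. rewrite (lsum_perm F _ _ Hr). cbn [lsum]. rewrite Hz. ring. }
apply (Rlt_irrefl (Theta K l)).
rewrite (Theta_same K _ _ E) at 2. apply Hlt.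
- apply (valid_same _ _ E Hv). intros q Hq. apply Hv.
  eapply Permutation_in; [symmetry; exact Hr|now right].
- now rewrite (Permutation_length Hr).
Qed.

(** Two equal points could be merged. *)
Lemma minimiser_distinct (K : R -> R) (l : list (R * R)) : valid l ->
  (forall l', valid l' -> S (length l') = length l -> Theta K l < Theta K l') ->
  forall p r q, Permutation l (p :: r) -> In q r -> snd q <> snd p.
Proof.
intros Hv Hlt p r q Hr Hq Heq.
destruct (In_perm _ _ Hq) as [s Hs].
assert (Hp' : Permutation l (p :: q :: s)).
{ etransitivity; [exact Hr|]. now constructor. }
assert (E : same_measure l ((fst p + fst q, snd p) :: s)).
{ intro F. rewrite (lsum_perm F _ _ Hp'). cbn [lsum fst snd]. rewrite Heq. ring. }
apply (Rlt_irrefl (Theta K l)).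
rewrite (Theta_same K _ _ E) at 2. apply Hlt.
- apply (valid_same _ _ E Hv).
  assert (V : forall x, In x (p :: q :: s) -> 0 <= fst x /\ 0 <= snd x <= 1).
  { intros x Hx. apply Hv. eapply Permutation_in; [symmetry; exact Hp'|exact Hx]. }
  intros x [<-|Hx]; simpl.
  + assert (A := V p (or_introl eq_refl)). assert (B := V q (or_intror (or_introl eq_refl))).
    lra.
  + apply V. now right; right.
- now rewrite (Permutation_length Hp').
Qed.

Lemma sorted_strict (l : list (R * R)) : points_sorted l ->
  (forall p r q, Permutation l (p :: r) -> In q r -> snd q <> snd p) ->
  StronglySorted (fun p q => snd p < snd q) l.
Proof.
induction l as [|a l IH]; intros Hs Hd; [constructor|].
inversion Hs as [|? ? Hs' Hf]; subst. constructor.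
- apply IH; [exact Hs'|]. intros p r q Hp Hq. apply (Hd p (a :: r)); [|now right].
  etransitivity; [apply perm_skip, Hp|apply perm_swap].
- rewrite Forall_forall in *. intros q Hq.
  assert (A := Hd a l q (Permutation_refl _) Hq). assert (B := Hf q Hq). lra.
Qed.

Lemma StronglySorted_nth (A : Type) (Rel : A -> A -> Prop) (d : A) (l : list A) :
  StronglySorted Rel l -> forall i j, (i < j < length l)%nat -> Rel (nth i l d) (nth j l d).
Proof.
induction 1 as [|a l Hs IH Hf]; intros i j Hij; simpl in Hij; [lia|].
destruct j as [|j]; [lia|]. destruct i as [|i]; simpl.
- rewrite Forall_forall in Hf. apply Hf, nth_In. lia.
- apply IH. lia.
Qed.

(** * Nonnegative monosplines of degree 4 *)

(** The monospline with [K'''' = 1 - sum a delta_tau], the pairs [(a, tau)]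
    running over [q], that is [x^4 / 24] to the left of the knots; and its first
    two derivatives. *)
Definition mono (q : list (R * R)) (x : R) : R := x ^ 4 / 24 - lsum (fun s => pp (x - s) ^ 3 / 6) q.
Definition mono1 (q : list (R * R)) (x : R) : R := x ^ 3 / 6 - lsum (fun s => pp (x - s) ^ 2 / 2) q.
Definition mono2 (q : list (R * R)) (x : R) : R := x ^ 2 / 2 - lsum (fun s => pp (x - s)) q.

Lemma is_derive_mono (q : list (R * R)) (x : R) : is_derive (mono q) x (mono1 q x).
Proof.
unfold mono, mono1. apply @is_derive_minus.
- auto_derive; [exact I|simpl; field].
- apply (is_derive_lsum (fun s x => pp (x - s) ^ 3 / 6) (fun s x => pp (x - s) ^ 2 / 2)). intro s.
  apply is_derive_ext with (fun x => 0 * pp (x - s) ^ 2 + / 6 * pp (x - s) ^ 3 + 0 * pp (x - s) ^ 4).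
  { intro t; simpl; field. }
  evar_last; [apply is_derive_pp_comb|simpl; field].
Qed.

Lemma is_derive_mono1 (q : list (R * R)) (x : R) : is_derive (mono1 q) x (mono2 q x).
Proof.
unfold mono1, mono2. apply @is_derive_minus.
- auto_derive; [exact I|simpl; field].
- apply (is_derive_lsum (fun s x => pp (x - s) ^ 2 / 2) (fun s x => pp (x - s))). intro s.
  apply is_derive_ext with (fun x => / 2 * pp (x - s) ^ 2 + 0 * pp (x - s) ^ 3 + 0 * pp (x - s) ^ 4).
  { intro t; simpl; field. }
  evar_last; [apply is_derive_pp_comb|simpl; field].
Qed.

Lemma continuous_mono (q : list (R * R)) (x : R) : continuous (mono q) x.
Proof. eapply continuous_of_derive, is_derive_mono. Qed.

(** The quantity below is [(w - x) (z - w) (z - x)] times the second divided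
    difference of [pp (. - v)] at [x], [w], [z]. *)
Lemma pp_convex (x w z v : R) : x < w < z ->
  0 <= (z - w) * pp (x - v) + (w - x) * pp (z - v) - (z - x) * pp (w - v).
Proof.
intro Hx. unfold pp, Rmax.
destruct (Rle_dec (x - v) 0), (Rle_dec (w - v) 0), (Rle_dec (z - v) 0); nra.
Qed.

Lemma pp_affine (x w z v : R) : x < w < z -> v <= x \/ z <= v ->
  (z - w) * pp (x - v) + (w - x) * pp (z - v) - (z - x) * pp (w - v) = 0.
Proof.
intros Hx [Hv|Hv].
- rewrite !pp_pos by lra. ring.
- rewrite !pp_neg by lra. ring.
Qed.

(** Without a knot of [q] in [(x, z)], the linear spline [L] would be convex on
    [[x, z]], with a proper kink at [y]; it could not vanish at [x], [w] and [z]. *)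
Lemma knot_between (c b y x w z : R) (l q : list (R * R)) :
  let L t := c + lsum (fun v => pp (t - v)) l - lsum (fun s => pp (t - s)) q in
  x < w < z -> L x = 0 -> L w = 0 -> L z = 0 ->
  (forall p, In p l -> 0 <= fst p) -> In (b, y) l -> 0 < b -> w < y < z ->
  exists p, In p q /\ x < snd p < z.
Proof.
intros L Hx Lx Lw Lz Hl Hy Hb Hyz. apply NNPP. intro Hq.
set (T := fun v => (z - w) * pp (x - v) + (w - x) * pp (z - v) - (z - x) * pp (w - v)).
assert (ET : forall m, lsum T m = (z - w) * lsum (fun v => pp (x - v)) m
  + (w - x) * lsum (fun v => pp (z - v)) m - (z - x) * lsum (fun v => pp (w - v)) m).
{ intro m. rewrite (lsum_ext T (fun v => ((z - w) * pp (x - v) + (w - x) * pp (z - v))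
    + - (z - x) * pp (w - v))).
  - rewrite lsum_plus, lsum_lin, lsum_scal. ring.
  - intros; unfold T; ring. }
assert (Q0 : lsum T q = 0).
{ rewrite (lsum_ext T (fun _ => 0 * 0)).
  - rewrite lsum_scal. ring.
  - intros p Hp. unfold T. rewrite pp_affine; [ring|exact Hx|].
    destruct (Rle_dec (snd p) x); [now left|]. destruct (Rle_dec z (snd p)); [now right|].
    exfalso. apply Hq. exists p. split; [exact Hp|lra]. }
assert (L0 : 0 < lsum T l).
{ destruct (In_perm _ _ Hy) as [r Hr]. rewrite (lsum_perm T _ _ Hr). cbn [lsum fst snd].
  assert (0 <= lsum T r).
  { apply lsum_nonneg. intros p Hp. apply Rmult_le_pos.
    - apply Hl. eapply Permutation_in; [symmetry; exact Hr|now right].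
    - now apply pp_convex. }
  assert (0 < T y).
  { unfold T. rewrite (pp_neg (x - y)), (pp_neg (w - y)), (pp_pos (z - y)) by lra.
    assert (0 < (w - x) * (z - y)) by (apply Rmult_lt_0_compat; lra). lra. }
  assert (0 < b * T y) by now apply Rmult_lt_0_compat. lra. }
rewrite ET in Q0, L0. unfold L in Lx, Lw, Lz.
replace (lsum (fun v => pp (x - v)) l) with (lsum (fun s => pp (x - s)) q - c) in L0 by lra.
replace (lsum (fun v => pp (w - v)) l) with (lsum (fun s => pp (w - s)) q - c) in L0 by lra.
replace (lsum (fun v => pp (z - v)) l) with (lsum (fun s => pp (z - s)) q - c) in L0 by lra.
lra.
Qed.

Lemma rolle (f f' : R -> R) (u v : R) : u < v ->
  (forall x, is_derive f x (f' x)) -> f u = f v -> exists c, u < c < v /\ f' c = 0.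
Proof.
intros Huv Hd Heq.
destruct (MVT_cor2 f f' u v Huv) as [c [Hc1 Hc2]].
- intros c _. now apply is_derive_Reals.
- exists c. split; [exact Hc2|]. rewrite Heq, Rminus_diag in Hc1.
  symmetry in Hc1. apply Rmult_integral in Hc1. destruct Hc1; lra.
Qed.

(** A measure that is critical for [mono q] has at most [length q + 4] points. By
    Rolle, the linear spline [(mono q + pot l)''] has two zeros between
    consecutive interior points [y k] and [y (S k)]; the first one is [p k]. There
    is a knot of [mono q] between [p k] and [p (S k)], because three zeros of a
    linear spline and a proper convex kink next to the last one exclude convexity. *)
Lemma count_points (q l : list (R * R)) (d : R) :
  (forall i j, (i < j < length q)%nat -> snd (nth i q (0, 0)) < snd (nth j q (0, 0))) ->
  (forall i j, (i < j < length l)%nat -> snd (nth i l (0, 0)) < snd (nth j l (0, 0))) ->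
  valid l -> (forall p, In p l -> 0 < fst p) ->
  (forall p, In p l -> mono q (snd p) + pot l (snd p) = d) ->
  (forall p c, In p l -> 0 < snd p < 1 ->
     is_derive (fun x => mono q x + pot l x) (snd p) c -> c = 0) ->
  (length l <= length q + 4)%nat.
Proof.
intros Sq Sl Hv Hpos Heq Hcrit.
destruct (Nat.le_gt_cases (length l) (length q + 4)) as [Hle|Hgt]; [exact Hle|exfalso].
set (y := fun k => snd (nth k l (0, 0))).
set (D := fun x => mono q x + pot l x).
set (D1 := fun x => mono1 q x + lsum (green1 x) l).
set (D2 := fun x => mono2 q x + lsum (green2 x) l).
assert (HD : forall x, is_derive D x (D1 x)).
{ intro x. apply @is_derive_plus; [apply is_derive_mono|].
  apply (is_derive_lsum (fun v u => green u v) (fun v u => green1 u v)).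
  intro v. apply is_derive_green. }
assert (HD1 : forall x, is_derive D1 x (D2 x)).
{ intro x. apply @is_derive_plus; [apply is_derive_mono1|].
  apply (is_derive_lsum (fun v u => green1 u v) (fun v u => green2 u v)).
  intro v. apply is_derive_green1. }
assert (Hin : forall k, (k < length l)%nat -> In (nth k l (0, 0)) l) by (intros; now apply nth_In).
assert (Hy01 : forall k, (1 <= k)%nat -> (k <= length q + 3)%nat -> 0 < y k < 1).
{ intros k Hk1 Hk2.
  assert (A := Sl 0%nat k ltac:(lia)). assert (B := Sl k (length q + 4)%nat ltac:(lia)).
  destruct (proj1 Hv _ (Hin 0%nat ltac:(lia))) as [_ A'].
  destruct (proj1 Hv _ (Hin (length q + 4)%nat ltac:(lia))) as [_ B'].
  unfold y. lra. }
assert (HDy : forall k, (k < length l)%nat -> D (y k) = d).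
{ intros k Hk. apply Heq, Hin, Hk. }
assert (HD1y : forall k, (1 <= k)%nat -> (k <= length q + 3)%nat -> D1 (y k) = 0).
{ intros k Hk1 Hk2. apply (Hcrit (nth k l (0, 0))).
  - apply Hin. lia.
  - now apply Hy01.
  - apply HD. }
assert (Z : forall k, exists p w, (1 <= k)%nat -> (k <= length q + 2)%nat ->
  y k < p < w /\ w < y (S k) /\ D2 p = 0 /\ D2 w = 0).
{ intro k. destruct (Nat.le_gt_cases 1 k) as [Hk1|Hk1]; [|exists 0, 0; lia].
  destruct (Nat.le_gt_cases k (length q + 2)) as [Hk2|Hk2]; [|exists 0, 0; lia].
  assert (Hlt : y k < y (S k)) by (apply Sl; lia).
  destruct (rolle D D1 (y k) (y (S k)) Hlt HD) as [z [Hz Dz]].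
  { rewrite !HDy by lia. reflexivity. }
  destruct (rolle D1 D2 (y k) z ltac:(lra) HD1) as [p [Hp Dp]].
  { rewrite HD1y by lia. now rewrite Dz. }
  destruct (rolle D1 D2 z (y (S k)) ltac:(lra) HD1) as [w [Hw Dw]].
  { rewrite HD1y by lia. exact Dz. }
  exists p, w. intros _ _. repeat split; lra. }
set (p := fun k => proj1_sig (constructive_indefinite_description _ (Z k))).
assert (Hp : forall k, exists w, (1 <= k)%nat -> (k <= length q + 2)%nat ->
  y k < p k < w /\ w < y (S k) /\ D2 (p k) = 0 /\ D2 w = 0).
{ intro k. unfold p. now destruct (constructive_indefinite_description _ (Z k)). }
clearbody p.
set (c := lsum (fun v => 1 / 6 - (1 - v) ^ 2 / 2) l).
assert (ED2 : forall x, D2 x = c + lsum (fun v => pp (x - v)) l - lsum (fun s => pp (x - s)) q).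
{ intro x. unfold D2, mono2, c.
  rewrite (lsum_ext (green2 x) (fun v => - x ^ 2 / 2 * 1 + ((1 / 6 - (1 - v) ^ 2 / 2) + pp (x - v)))).
  - rewrite (lsum_plus (fun _ => - x ^ 2 / 2 * 1)), (lsum_scal (- x ^ 2 / 2) (fun _ => 1)),
      (proj2 Hv), lsum_plus. field.
  - intros; unfold green2; ring. }
assert (Kn : forall k, (1 <= k)%nat -> (k <= length q + 1)%nat ->
  exists i, (i < length q)%nat /\ p k < snd (nth i q (0, 0)) < p (S k)).
{ intros k Hk1 Hk2.
  destruct (Hp k) as [w Hw]. destruct (Hw Hk1 ltac:(lia)) as [A1 [A2 [A3 A4]]].
  destruct (Hp (S k)) as [w' Hw']. destruct (Hw' ltac:(lia) ltac:(lia)) as [B1 [B2 [B3 B4]]].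
  rewrite ED2 in A3, A4, B3.
  destruct (knot_between c (fst (nth (S k) l (0, 0))) (y (S k)) (p k) w (p (S k)) l q)
    as [s [Hs1 Hs2]]; try assumption; try lra.
  - intros r Hr. left. now apply Hpos.
  - unfold y. rewrite <- surjective_pairing. apply Hin. lia.
  - apply Hpos, Hin. lia.
  - destruct (In_nth _ _ (0, 0) Hs1) as [i [Hi <-]]. now exists i. }
assert (F : forall k, (1 <= k)%nat -> (k <= length q + 1)%nat ->
  exists i, (k <= S i)%nat /\ (i < length q)%nat /\ p k < snd (nth i q (0, 0)) < p (S k)).
{ induction k as [|k IH]; intros Hk1 Hk2; [lia|].
  destruct (Kn (S k) Hk1 Hk2) as [i [Hi Hpi]].
  exists i. split; [|now split].
  destruct (Nat.eq_dec k 0) as [->|Hk0]; [lia|].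
  destruct (IH ltac:(lia) ltac:(lia)) as [j [Hj [Hjq Hpj]]].
  assert (j < i)%nat; [|lia].
  destruct (Nat.lt_trichotomy j i) as [Hji|[->|Hji]]; [exact Hji|lra|].
  assert (A := Sq i j ltac:(lia)). lra. }
destruct (F (length q + 1)%nat ltac:(lia) ltac:(lia)) as [i [Hi [Hi' _]]]. lia.
Qed.

(** Compare the minimal energies over [N + 4] and [N + 5] points, where
    [N = length q]. If they are equal, the potential is bounded below by the
    energy, and it is enough to integrate, as potentials have mean value 0. They
    cannot differ: a strict decrease forces a critical measure with [N + 5]
    distinct points. *)
Lemma mono_lower (q : list (R * R)) :
  (forall i j, (i < j < length q)%nat -> snd (nth i q (0, 0)) < snd (nth j q (0, 0))) ->
  (forall x, 0 <= x <= 1 -> 0 <= mono q x) ->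
  1 / (720 * (INR (length q) + 5) ^ 4) <= RInt (mono q) 0 1.
Proof.
intros Sq HK.
assert (HKc := continuous_mono q).
destruct (Theta_min_exists (mono q) (length q + 4) HK HKc ltac:(lia)) as [l1 [V1 [E1 M1]]].
destruct (Theta_min_exists (mono q) (length q + 5) HK HKc ltac:(lia)) as [l2 [V2 [E2 M2]]].
destruct (Rle_lt_dec (Theta (mono q) l1) (Theta (mono q) l2)) as [Hle|Hlt].
- assert (P := potential_lower (mono q) l1 V1).
  assert (P' : forall y, 0 <= y <= 1 -> energy l1 + lsum (mono q) l1 <= mono q y + pot l1 y).
  { apply P. intros l' V' E'. apply Rle_trans with (1 := Hle), M2; [exact V'|lia]. }
  assert (K0 : 0 <= lsum (mono q) l1).
  { apply lsum_nonneg. intros p Hp. destruct (proj1 V1 p Hp). apply Rmult_le_pos; auto. }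
  assert (EL := energy_lower l1 (valid_in01 l1 V1) (proj2 V1)).
  rewrite E1, plus_INR in EL. replace (INR 4) with 4 in EL by (simpl; ring).
  replace (INR (length q) + 4 + 1) with (INR (length q) + 5) in EL by ring.
  apply Rle_trans with (1 := EL).
  assert (IK : is_RInt (mono q) 0 1 (RInt (mono q) 0 1)).
  { apply (@RInt_correct R_CompleteNormedModule), (@ex_RInt_continuous R_CompleteNormedModule).
    intros; apply HKc. }
  assert (IP : is_RInt (pot l1) 0 1 0).
  { replace 0 with (lsum (fun _ => 0 * 0) l1) at 2 by (rewrite lsum_scal; ring).
    apply (is_RInt_lsum (fun v u => green u v)). intros p Hp. rewrite Rmult_0_l.
    apply is_RInt_green, (valid_in01 l1 V1 p Hp). }
  assert (IS := is_RInt_plus _ _ _ _ _ _ IK IP).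
  assert (IC : is_RInt (fun _ => energy l1) 0 1 (energy l1)).
  { apply (is_RInt_primitive (fun x => energy l1 * x)).
    - intro x. auto_derive; [exact I|ring].
    - intro x. apply continuous_const.
    - ring. }
  assert (C := is_RInt_le _ _ _ _ _ _ Rle_0_1 IC IS).
  match type of C with _ -> _ <= plus ?a ?b => change (plus a b) with (a + b) in C end.
  rewrite Rplus_0_r in C. apply C. intros x Hx.
  assert (A := P' x ltac:(lra)).
  change (energy l1 <= mono q x + pot l1 x). lra.
- exfalso.
  destruct (sort_exists l2) as [l [Hp Hs]].
  assert (Es := perm_same _ _ Hp).
  assert (V : valid l).
  { apply (valid_same _ _ Es V2). intros p Hin. apply V2.
    eapply Permutation_in; [symmetry; exact Hp|exact Hin]. }
  assert (El := Permutation_length Hp).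
  assert (M : forall l', valid l' -> length l' = length l -> Theta (mono q) l <= Theta (mono q) l').
  { intros l' V' E'. rewrite <- (Theta_same _ _ _ Es). apply M2; [exact V'|congruence]. }
  assert (S : forall l', valid l' -> S (length l') = length l ->
    Theta (mono q) l < Theta (mono q) l').
  { intros l' V' E'. rewrite <- (Theta_same _ _ _ Es). apply Rlt_le_trans with (1 := Hlt).
    apply M1; [exact V'|lia]. }
  assert (Hpos : forall p, In p l -> 0 < fst p)
    by (intros p Hin; exact (minimiser_positive _ _ p V S Hin)).
  cut (length l <= length q + 4)%nat; [lia|].
  apply count_points with (energy l + lsum (mono q) l); try assumption.
  + intros i j Hij. apply (StronglySorted_nth _ (fun p q => snd p < snd q)); [|exact Hij].
    apply sorted_strict; [exact Hs|]. now apply (minimiser_distinct (mono q)).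
  + intros [b y] Hin. apply (potential_support _ _ b y V M Hin). apply (Hpos _ Hin).
  + intros [b y] c Hin Hy Hc. apply (potential_critical _ _ b y c V M Hin); try assumption.
    apply (Hpos _ Hin).
Qed.

(** * Functions of class C^4 *)

(** [f] has the successive derivatives [f1], ..., [f4] on the whole line. *)
Definition C4_line (f f1 f2 f3 f4 : R -> R) : Prop :=
  (forall x, is_derive f x (f1 x)) /\ (forall x, is_derive f1 x (f2 x)) /\
  (forall x, is_derive f2 x (f3 x)) /\ (forall x, is_derive f3 x (f4 x)) /\
  (forall x, continuous f4 x).

Lemma derivative_on_of_derive (f g : R -> R) :
  (forall x, is_derive f x (g x)) -> derivative_on_I01 f g.
Proof.
intros H x _. apply D_in_imp with no_cond; [intros; exact I|].
apply derivable_pt_lim_D_in. apply is_derive_Reals, H.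
Qed.

Lemma C4_I01_of_line (f f1 f2 f3 f4 : R -> R) : C4_line f f1 f2 f3 f4 -> C4_I01 f f4.
Proof.
intros [D1 [D2 [D3 [D4 C4]]]]. exists f1, f2, f3.
repeat split; try (now apply derivative_on_of_derive).
intros x _ eps Heps.
assert (Hc : continuity_pt f4 x) by apply continuity_pt_filterlim, C4.
destruct (Hc eps Heps) as [d [Hd0 Hd]].
exists d. split; [exact Hd0|]. intros y [[_ Hxy] Hy]. apply Hd.
split; [split; [exact I|exact Hxy]|exact Hy].
Qed.

(** The projection onto [[0, 1]]. *)
Definition clamp (x : R) : R := 1 - pp (1 - pp x).

Lemma clamp_I01 (x : R) : I01 (clamp x).
Proof.
unfold clamp, I01. assert (A := pp_ge0 x). assert (B := pp_ge0 (1 - pp x)).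
split; [|lra]. destruct (Rle_dec (pp x) 1); [rewrite pp_pos|rewrite pp_neg]; lra.
Qed.

Lemma clamp_id (x : R) : I01 x -> clamp x = x.
Proof. unfold I01, clamp. intros Hx. rewrite !pp_pos; try rewrite pp_pos; lra. Qed.

Lemma clamp_lip (x y : R) : Rabs (clamp x - clamp y) <= Rabs (x - y).
Proof.
unfold clamp. replace (_ - _) with (pp (1 - pp y) - pp (1 - pp x)) by ring.
eapply Rle_trans; [apply pp_lip|].
replace (_ - _) with (pp x - pp y) by ring. apply pp_lip.
Qed.

Lemma continuous_clamp (f : R -> R) (x : R) :
  (forall x, I01 x -> continue_in f I01 x) -> continuous (fun x => f (clamp x)) x.
Proof.
intros Hf. apply continuity_pt_filterlim. intros eps Heps.
destruct (Hf (clamp x) (clamp_I01 x) eps Heps) as [d [Hd0 Hd]].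
exists d. split; [exact Hd0|]. intros y [_ Hy].
destruct (Req_dec (clamp y) (clamp x)) as [E|E].
- rewrite E. simpl. unfold Rdist. rewrite Rminus_diag, Rabs_R0. exact Heps.
- apply Hd. split; [split; [apply clamp_I01|congruence]|].
  simpl in *. unfold Rdist in *. eapply Rle_lt_trans; [apply clamp_lip|exact Hy].
Qed.

Lemma derive_clamp (f g : R -> R) (x : R) : D_in f g I01 x -> 0 < x < 1 ->
  is_derive (fun x => f (clamp x)) x (g x).
Proof.
intros Hf Hx. apply is_derive_Reals. intros eps Heps.
destruct (Hf eps Heps) as [d [Hd0 Hd]].
assert (Hm : 0 < Rmin d (Rmin x (1 - x))) by (repeat apply Rmin_pos; lra).
exists (mkposreal _ Hm). intros h Hh0 Hh. simpl in Hh.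
assert (Hh1 : Rabs h < d) by (eapply Rlt_le_trans; [exact Hh|apply Rmin_l]).
assert (Hh2 : Rabs h < Rmin x (1 - x)) by (eapply Rlt_le_trans; [exact Hh|apply Rmin_r]).
assert (Hh3 : Rabs h < x) by (eapply Rlt_le_trans; [exact Hh2|apply Rmin_l]).
assert (Hh4 : Rabs h < 1 - x) by (eapply Rlt_le_trans; [exact Hh2|apply Rmin_r]).
apply Rabs_def2 in Hh3. apply Rabs_def2 in Hh4.
rewrite !clamp_id by (unfold I01; lra).
assert (A := Hd (x + h)). simpl in A. unfold Rdist in A.
replace (x + h - x) with h in A by ring. apply A.
split; [split; [unfold I01; lra|lra]|exact Hh1].
Qed.

(** A primitive of an extension of the derivative extends the function. *)
Lemma extend_primitive (f g G : R -> R) : derivative_on_I01 f g ->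
  (forall x, continuous G x) -> (forall x, I01 x -> G x = g x) ->
  exists F, (forall x, is_derive F x (G x)) /\ (forall x, I01 x -> F x = f x).
Proof.
intros Hf HG HGg. exists (fun x => f 0 + RInt G 0 x).
assert (HF : forall x, is_derive (fun x => f 0 + RInt G 0 x) x (G x)).
{ intro x. evar_last.
  - apply @is_derive_plus; [apply is_derive_const|].
    apply (is_derive_RInt G (fun x => RInt G 0 x) 0 x); [|apply HG].
    exists (mkposreal 1 Rlt_0_1). intros y _.
    apply (@RInt_correct R_CompleteNormedModule), (@ex_RInt_continuous R_CompleteNormedModule).
    intros; apply HG.
  - unfold plus, zero; simpl. ring. }
split; [exact HF|].
intros x Hx. set (F := fun x => f 0 + RInt G 0 x) in *.
assert (Cf : forall x, continuous (fun x => f (clamp x)) x).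
{ intro t. apply continuous_clamp. intros s Hs. apply cont_deriv with g. now apply Hf. }
destruct (MVT_gen (fun x => F x - f (clamp x)) 0 x (fun _ => 0)) as [c [_ Hc]].
- intros t Ht. rewrite Rmin_left, Rmax_right in Ht by apply Hx.
  assert (Ht' : 0 < t < 1) by (destruct Hx; lra).
  rewrite <- (Rminus_diag (G t)). apply @is_derive_minus; [apply HF|].
  rewrite HGg by (unfold I01; lra). apply derive_clamp; [|exact Ht'].
  apply Hf. unfold I01; lra.
- intros t _. apply continuity_pt_filterlim.
  apply (continuous_minus F (fun x => f (clamp x))); [|apply Cf].
  eapply continuous_of_derive, HF.
- rewrite (clamp_id x Hx), (clamp_id 0) in Hc by (unfold I01; lra).
  assert (F0 : F 0 = f 0).
  { unfold F. rewrite RInt_point. change (f 0 + 0 = f 0). ring. }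
  change (F x - f x - (F 0 - f 0) = 0 * (x - 0)) in Hc.
  change (F x = f x). lra.
Qed.

Lemma C4_extend (f f4 : R -> R) : C4_I01 f f4 -> exists F F1 F2 F3 F4,
  C4_line F F1 F2 F3 F4 /\ (forall x, I01 x -> F x = f x) /\
  (forall x, I01 x -> F4 x = f4 x).
Proof.
intros [f1 [f2 [f3 [D1 [D2 [D3 [D4 C4]]]]]]].
set (F4 := fun x => f4 (clamp x)).
assert (E4 : forall x, I01 x -> F4 x = f4 x) by (intros x Hx; unfold F4; now rewrite clamp_id).
assert (C : forall x, continuous F4 x) by (intro; now apply continuous_clamp).
destruct (extend_primitive f3 f4 F4 D4 C E4) as [F3 [H3 E3]].
destruct (extend_primitive f2 f3 F3 D3) as [F2 [H2 E2]];
  [intro; eapply continuous_of_derive, H3|exact E3|].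
destruct (extend_primitive f1 f2 F2 D2) as [F1 [H1 E1]];
  [intro; eapply continuous_of_derive, H2|exact E2|].
destruct (extend_primitive f f1 F1 D1) as [F [H0 E0]];
  [intro; eapply continuous_of_derive, H1|exact E1|].
exists F, F1, F2, F3, F4. split; [|split; [exact E0|exact E4]].
exact (conj H0 (conj H1 (conj H2 (conj H3 C)))).
Qed.

(** * Remainders on subintervals *)

Lemma ex_RInt_derivable (f f1 : R -> R) (u v : R) :
  (forall x, is_derive f x (f1 x)) -> ex_RInt f u v.
Proof.
intro Hf. apply (@ex_RInt_continuous R_CompleteNormedModule).
intros; eapply continuous_of_derive, Hf.
Qed.

(** Integration by parts of [p f4] over [[u, u + h]], where
    [p (u + t) = t^4/24 + A t^3/6 + B t^2/2 + C t + D] is nonnegative. *)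
Lemma quartic_piece (f f1 f2 f3 f4 : R -> R) (m u v h A B C D : R) :
  C4_line f f1 f2 f3 f4 -> 0 <= h -> v = u + h ->
  (forall x, u <= x <= v -> m <= f4 x) ->
  (forall t, 0 <= t <= h -> 0 <= t ^ 4 / 24 + A * t ^ 3 / 6 + B * t ^ 2 / 2 + C * t + D) ->
  m * (h ^ 5 / 120 + A * h ^ 4 / 24 + B * h ^ 3 / 6 + C * h ^ 2 / 2 + D * h) <=
  RInt f u v
  + (h ^ 4 / 24 + A * h ^ 3 / 6 + B * h ^ 2 / 2 + C * h + D) * f3 v
  - (h ^ 3 / 6 + A * h ^ 2 / 2 + B * h + C) * f2 v
  + (h ^ 2 / 2 + A * h + B) * f1 v - (h + A) * f v
  - D * f3 u + C * f2 u - B * f1 u + A * f u.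
Proof.
intros [D1 [D2 [D3 [D4 C4]]]] Hh Hv Hm Hp.
set (p := fun x => (x - u) ^ 4 / 24 + A * (x - u) ^ 3 / 6 + B * (x - u) ^ 2 / 2 + C * (x - u) + D).
set (p1 := fun x => (x - u) ^ 3 / 6 + A * (x - u) ^ 2 / 2 + B * (x - u) + C).
set (p2 := fun x => (x - u) ^ 2 / 2 + A * (x - u) + B).
set (p3 := fun x => (x - u) + A).
assert (P0 : forall x, is_derive p x (p1 x)).
{ intro x. unfold p, p1. auto_derive; [exact I|field]. }
assert (P1 : forall x, is_derive p1 x (p2 x)).
{ intro x. unfold p1, p2. auto_derive; [exact I|field]. }
assert (P2 : forall x, is_derive p2 x (p3 x)).
{ intro x. unfold p2, p3. auto_derive; [exact I|field]. }
assert (P3 : forall x, is_derive p3 x 1).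
{ intro x. unfold p3. auto_derive; [exact I|ring]. }
assert (Cp : forall x, continuous p x) by (intro; eapply continuous_of_derive, P0).
assert (Cf : forall x, continuous f x) by (intro; eapply continuous_of_derive, D1).
assert (M : forall (g g' k k' : R -> R) x, is_derive g x (g' x) -> is_derive k x (k' x) ->
  is_derive (fun x => g x * k x) x (g' x * k x + g x * k' x)).
{ intros g g' k k' x Hg Hk. apply (is_derive_mult g k x (g' x) (k' x) Hg Hk).
  intros a b. apply Rmult_comm. }
set (W := fun x => p x * f3 x - p1 x * f2 x + p2 x * f1 x - p3 x * f x).
assert (I1 : is_RInt (fun x => p x * f4 x - f x) u v (W v - W u)).
{ apply (is_RInt_primitive W); [| |reflexivity].
  - intro x. evar_last.
    + unfold W. apply @is_derive_minus; [apply @is_derive_plus; [apply @is_derive_minus|]|].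
      * apply (M p p1 f3 f4); auto.
      * apply (M p1 p2 f2 f3); auto.
      * apply (M p2 p3 f1 f2); auto.
      * apply (M p3 (fun _ => 1) f f1); auto.
    + unfold minus, plus, opp; simpl. ring.
  - intro x. apply (continuous_minus (fun x => p x * f4 x) f); [|apply Cf].
    apply (continuous_mult p f4); [apply Cp|apply C4]. }
assert (I2 : is_RInt f u v (RInt f u v)).
{ apply (@RInt_correct R_CompleteNormedModule). now apply ex_RInt_derivable with f1. }
assert (I3 := is_RInt_plus _ _ _ _ _ _ I1 I2).
assert (I4 : is_RInt (fun x => m * p x) u v
  (m * (h ^ 5 / 120 + A * h ^ 4 / 24 + B * h ^ 3 / 6 + C * h ^ 2 / 2 + D * h))).
{ apply (is_RInt_primitive (fun x => m * ((x - u) ^ 5 / 120 + A * (x - u) ^ 4 / 24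
    + B * (x - u) ^ 3 / 6 + C * (x - u) ^ 2 / 2 + D * (x - u)))).
  - intro x. unfold p. auto_derive; [exact I|field].
  - intro x. apply (continuous_mult (fun _ => m) p); [apply continuous_const|apply Cp].
  - subst v. replace (u + h - u) with h by ring. field. }
assert (Le := is_RInt_le _ _ u v _ _ ltac:(lra) I4 I3).
match type of Le with _ -> _ <= plus ?a ?b => change (plus a b) with (a + b) in Le end.
eapply Rle_trans; [apply Le|].
- intros x Hx. change (m * p x <= p x * f4 x - f x + f x).
  assert (0 <= p x) by (apply (Hp (x - u)); lra).
  assert (m <= f4 x) by (apply Hm; lra). nra.
- right. unfold W, p, p1, p2, p3. subst v.
  replace (u + h - u) with h by ring. rewrite Rminus_diag. field.
Qed.

Lemma interior_piece (f f1 f2 f3 f4 : R -> R) (m u v h : R) :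
  C4_line f f1 f2 f3 f4 -> 0 <= h -> v = u + h ->
  (forall x, u <= x <= v -> m <= f4 x) ->
  m * (h ^ 5 / 720) <=
  RInt f u v - h / 2 * f u - h / 2 * f v + h ^ 2 / 12 * f1 v - h ^ 2 / 12 * f1 u.
Proof.
intros Hf Hh Hv Hm.
assert (P := quartic_piece f f1 f2 f3 f4 m u v h (- h / 2) (h ^ 2 / 12) 0 0 Hf Hh Hv Hm).
eapply Rle_trans; [|eapply Rle_trans; [apply P|]].
- right; field.
- intros t Ht.
  replace (_ + _ + _ + _ + _) with ((t * (h - t)) ^ 2 / 24) by field.
  assert (0 <= (t * (h - t)) ^ 2) by apply pow2_ge_0. lra.
- right; field.
Qed.

(** The block of the formula next to 0, with [h = 1 / n]; its kernel vanishes to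
    second order at [h], like those of the interior pieces. *)
Lemma left_block (f f1 f2 f3 f4 : R -> R) (m h : R) :
  C4_line f f1 f2 f3 f4 -> 0 <= h ->
  (forall x, 0 <= x <= h -> m <= f4 x) ->
  m * (11 / 11520 * h ^ 5) <=
  RInt f 0 h + h / 12 * f 0 - 8 / 9 * h * f (h / 4) + h / 3 * f (h / 2)
  - 19 / 36 * h * f h + h ^ 2 / 12 * f1 h.
Proof.
intros Hf Hh Hm.
(* The last numerical arguments are the derivatives of the kernel at the left end
   of each piece, from the third one down to the kernel itself. The third one
   jumps at a node by the opposite of the weight, the others are carried over
   from the preceding piece. *)
assert (P1 := quartic_piece f f1 f2 f3 f4 m 0 (h / 4) (h / 4) (h / 12) 0 0 0 Hf
  ltac:(lra) ltac:(lra) ltac:(intros; apply Hm; lra)).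
assert (P2 := quartic_piece f f1 f2 f3 f4 m (h / 4) (h / 2) (h / 4) (- 5 * h / 9)
  (5 * h ^ 2 / 96) (h ^ 3 / 192) (7 * h ^ 4 / 18432) Hf
  ltac:(lra) ltac:(field) ltac:(intros; apply Hm; lra)).
assert (P3 := quartic_piece f f1 f2 f3 f4 m (h / 2) h (h / 2) (h / 36)
  (- h ^ 2 / 18) (h ^ 3 / 288) (7 * h ^ 4 / 3456) Hf
  ltac:(lra) ltac:(field) ltac:(intros; apply Hm; lra)).
assert (I1 : RInt f 0 h = RInt f 0 (h / 4) + RInt f (h / 4) (h / 2) + RInt f (h / 2) h).
{ rewrite <- (RInt_Chasles f 0 (h / 2) h), <- (RInt_Chasles f 0 (h / 4) (h / 2));
    try (now apply ex_RInt_derivable with f1, (proj1 Hf)). reflexivity. }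
assert (h2 : 0 <= h ^ 2) by (apply pow_le; lra).
assert (h3 : 0 <= h ^ 3) by (apply pow_le; lra).
assert (h4 : 0 <= h ^ 4) by (apply pow_le; lra).
rewrite I1.
assert (Q1 := P1 ltac:(
  intros t Ht; assert (0 <= t ^ 4) by (apply pow_le; lra);
  assert (0 <= t ^ 3) by (apply pow_le; lra); nra)).
assert (Q2 := P2 ltac:(
  intros t Ht; assert (0 <= t ^ 4) by (apply pow_le; lra);
  assert (0 <= h ^ 3 * t) by (apply Rmult_le_pos; lra);
  assert (0 <= h * t ^ 2 * (h / 4 - t))
    by (apply Rmult_le_pos; [apply Rmult_le_pos; [lra|apply pow2_ge_0]|lra]);
  assert (0 <= (h * t) ^ 2) by apply pow2_ge_0; nra)).
(* On the third piece the kernel is [r^2 (9 r^2 - 19 r h + 9 h^2) / 216], where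
   [r = h / 2 - t]. *)
assert (Q3 := P3 ltac:(
  intros t Ht;
  replace (_ + _ + _ + _ + _) with
    ((h / 2 - t) ^ 2 * (9 * (h / 2 + t) ^ 2 - h * (h / 2 - t)) / 216) by field;
  apply Rdiv_le_0_compat; [apply Rmult_le_pos; [apply pow2_ge_0|nra]|lra])).
clear P1 P2 P3.
eapply Rle_trans; [|eapply Rle_trans;
  [apply (Rplus_le_compat _ _ _ _ (Rplus_le_compat _ _ _ _ Q1 Q2) Q3)|]].
- right; field.
- right; field.
Qed.

(** The mirror image of the left block. *)
Lemma right_block (f f1 f2 f3 f4 : R -> R) (m h : R) :
  C4_line f f1 f2 f3 f4 -> 0 <= h ->
  (forall x, 1 - h <= x <= 1 -> m <= f4 x) ->
  m * (11 / 11520 * h ^ 5) <=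
  RInt f (1 - h) 1 + h / 12 * f 1 - 8 / 9 * h * f (1 - h / 4) + h / 3 * f (1 - h / 2)
  - 19 / 36 * h * f (1 - h) - h ^ 2 / 12 * f1 (1 - h).
Proof.
intros [D1 [D2 [D3 [D4 C4]]]] Hh Hm.
assert (Dr : forall (g g' : R -> R) (c x : R), is_derive g (1 - x) (g' (1 - x)) ->
  is_derive (fun x => c * g (1 - x)) x (- c * g' (1 - x))).
{ intros g g' c x Hg. replace (- c * g' (1 - x)) with (c * (-1 * g' (1 - x))) by ring.
  apply (is_derive_scal (fun x => g (1 - x)) x c).
  apply (is_derive_comp g (fun x => 1 - x)); [exact Hg|]. auto_derive; [exact I|ring]. }
assert (Hr : C4_line (fun x => 1 * f (1 - x)) (fun x => - (1) * f1 (1 - x))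
  (fun x => - - (1) * f2 (1 - x)) (fun x => - - - (1) * f3 (1 - x))
  (fun x => - - - - (1) * f4 (1 - x))).
{ split; [|split; [|split; [|split]]]; intro x; try (apply Dr; auto).
  apply (continuous_mult (fun _ => - - - - (1)) (fun x => f4 (1 - x)));
    [apply continuous_const|].
  apply (continuous_comp (fun x => 1 - x) f4); [|apply C4].
  apply (continuous_of_derive _ _ (-1)). auto_derive; [exact I|ring]. }
assert (P := left_block _ _ _ _ _ m h Hr Hh).
eapply Rle_trans; [apply P|].
- intros x Hx. rewrite !Ropp_involutive, Rmult_1_l. apply Hm. lra.
- right. replace (RInt (fun x => 1 * f (1 - x)) 0 h) with (RInt f (1 - h) 1).
  + rewrite Rminus_0_r. field.
  + assert (Ex : forall u v, ex_RInt f u v) by (intros; now apply ex_RInt_derivable with f1).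
    assert (E := RInt_comp_lin f (-1) 1 0 h (Ex _ _)).
    replace (-1 * 0 + 1) with 1 in E by ring. replace (-1 * h + 1) with (1 - h) in E by ring.
    rewrite <- (opp_RInt_swap f 1 (1 - h)) by apply Ex.
    assert (Ex' : ex_RInt (fun x => 1 * f (1 - x)) 0 h).
    { apply ex_RInt_derivable with (fun x => - (1) * f1 (1 - x)). apply Hr. }
    assert (E' : RInt (fun y => scal (-1) (f (-1 * y + 1))) 0 h =
      opp (RInt (fun x => 1 * f (1 - x)) 0 h)).
    { rewrite <- RInt_opp by exact Ex'. apply RInt_ext. intros x _.
      change (-1 * f (-1 * x + 1) = - (1 * f (1 - x))).
      replace (-1 * x + 1) with (1 - x) by ring. ring. }
    rewrite (eq_trans (eq_sym E) E'). apply opp_opp.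
Qed.

(** The terms with [f1] telescope. *)
Lemma interior_blocks (f f1 f2 f3 f4 : R -> R) (m h : R) (j : nat) :
  C4_line f f1 f2 f3 f4 -> 0 <= h ->
  (forall x, 0 <= x <= h * INR (j + 2) -> m <= f4 x) ->
  m * (INR (j + 1) * (h ^ 5 / 720)) <=
  RInt f h (h * INR (j + 2)) - h / 2 * f h - h * sum_n_m (fun k => f (h * INR k)) 2 (j + 1)
  - h / 2 * f (h * INR (j + 2))
  + h ^ 2 / 12 * f1 (h * INR (j + 2)) - h ^ 2 / 12 * f1 h.
Proof.
intros Hf Hh. induction j as [|j IH]; intro Hm.
- rewrite sum_n_m_zero by lia. change (@zero R_AbelianMonoid) with 0.
  change (INR (0 + 2)) with (1 + 1) in *. change (INR (0 + 1)) with 1.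
  replace (h * (1 + 1)) with (h + h) in * by ring.
  assert (P := interior_piece f f1 f2 f3 f4 m h (h + h) h Hf Hh eq_refl
    ltac:(intros; apply Hm; lra)). lra.
- assert (E2 : INR (S j + 2) = INR (j + 2) + 1) by (rewrite <- S_INR; f_equal).
  assert (E1 : INR (S j + 1) = INR (j + 1) + 1) by (rewrite <- S_INR; f_equal).
  assert (0 <= INR (j + 2)) by apply pos_INR.
  rewrite E2 in Hm. rewrite E1, E2.
  assert (Q := IH ltac:(intros x Hx; apply Hm; nra)).
  assert (P := interior_piece f f1 f2 f3 f4 m (h * INR (j + 2)) (h * (INR (j + 2) + 1)) h Hf Hh
    ltac:(ring) ltac:(intros; apply Hm; split; [nra|lra])).
  rewrite <- (RInt_Chasles f h (h * INR (j + 2)));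
    try (now apply ex_RInt_derivable with f1, (proj1 Hf)).
  change (S j + 1)%nat with (S (j + 1)). rewrite sum_n_Sm by lia.
  replace (S (j + 1)) with (j + 2)%nat by lia.
  repeat match goal with |- context [plus ?a ?b] => change (plus a b) with (a + b) end.
  lra.
Qed.

(** * The formula with [n + 5] points *)

Lemma Qn5_lower (n : nat) (f f1 f2 f3 f4 : R -> R) (m : R) : (3 <= n)%nat ->
  C4_line f f1 f2 f3 f4 -> (forall x, 0 <= x <= 1 -> m <= f4 x) ->
  m * (1 / (720 * INR n ^ 4) * (1 - 5 / (8 * INR n))) <= remainder (Qn5 n) f.
Proof.
intros Hn Hf Hm.
assert (Hn3 : 3 <= INR n) by (apply (le_INR 3) in Hn; simpl in Hn; lra).
set (h := / INR n).
assert (Hh : 0 < h) by (apply Rinv_0_lt_compat; lra).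
assert (Ehn : h * INR n = 1) by (unfold h; field; lra).
destruct (Nat.le_exists_sub 3 n Hn) as [j [Ej _]].
assert (E2 : INR (j + 2) = INR n - 1).
{ rewrite Ej, !plus_INR. simpl. ring. }
assert (E1 : INR (j + 1) = INR n - 2).
{ rewrite Ej, !plus_INR. simpl. ring. }
assert (E3 : h * INR (j + 2) = 1 - h) by (rewrite E2; lra).
assert (Hh3 : h <= 1 / 3) by (apply Rmult_le_reg_r with (INR n); lra).
assert (P1 := left_block f f1 f2 f3 f4 m h Hf ltac:(lra) ltac:(intros; apply Hm; lra)).
assert (P2 := interior_blocks f f1 f2 f3 f4 m h j Hf ltac:(lra)).
rewrite E3, E1 in P2.
assert (P2' := P2 ltac:(intros; apply Hm; lra)). clear P2.
assert (P3 := right_block f f1 f2 f3 f4 m h Hf ltac:(lra) ltac:(intros; apply Hm; lra)).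
assert (EI : RInt f 0 1 = RInt f 0 h + RInt f h (1 - h) + RInt f (1 - h) 1).
{ rewrite <- (RInt_Chasles f 0 (1 - h) 1), <- (RInt_Chasles f 0 h (1 - h));
    try (now apply ex_RInt_derivable with f1, (proj1 Hf)). reflexivity. }
unfold remainder, Qn5, Defs.sigma. rewrite EI.
replace (n - 2)%nat with (j + 1)%nat by lia.
rewrite (sum_n_m_ext (fun k => f (INR k / INR n)) (fun k => f (h * INR k)))
  by (intro k; f_equal; unfold h, Rdiv; ring).
replace (1 / (4 * INR n)) with (h / 4) by (unfold h; field; lra).
replace (1 / (2 * INR n)) with (h / 2) by (unfold h; field; lra).
replace (1 / (12 * INR n)) with (h / 12) by (unfold h; field; lra).
replace (8 / (9 * INR n)) with (8 / 9 * h) by (unfold h; field; lra).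
replace (1 / (3 * INR n)) with (h / 3) by (unfold h; field; lra).
replace (37 / (36 * INR n)) with (37 / 36 * h) by (unfold h; field; lra).
replace (1 / INR n) with h by (unfold h; field; lra).
replace (1 / (720 * INR n ^ 4) * (1 - 5 / (8 * INR n)))
  with (2 * (11 / 11520 * h ^ 5) + (INR n - 2) * (h ^ 5 / 720)) by (unfold h; field; lra).
rewrite Rminus_0_r. lra.
Qed.

(** * Quadrature formulas as measures *)

Lemma lsum_app (F : R -> R) (l1 l2 : list (R * R)) :
  lsum F (l1 ++ l2) = lsum F l1 + lsum F l2.
Proof. induction l1 as [|p l1 IH]; simpl; [ring|rewrite IH; ring]. Qed.

(** A quadrature formula as a finite measure. *)
Lemma quadrature_list (N : nat) (Q : (R -> R) -> R) : quadrature_formula N Q ->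
  exists q, length q = N /\ in01 q /\
    (forall i j, (i < j < length q)%nat -> snd (nth i q (0, 0)) < snd (nth j q (0, 0))) /\
    forall f, Q f = lsum f q.
Proof.
intros [a [tau [Ht [Hs HQ]]]].
set (g := fun i => (a i, tau i)).
assert (L : length (map g (seq 1 N)) = N) by now rewrite length_map, length_seq.
assert (Nth : forall i, (i < N)%nat -> nth i (map g (seq 1 N)) (0, 0) = g (S i)).
{ intros i Hi. rewrite (nth_indep _ _ (g 0%nat)) by (rewrite L; exact Hi).
  rewrite map_nth, seq_nth by exact Hi. reflexivity. }
exists (map g (seq 1 N)). split; [exact L|split; [|split]].
- intros p Hp. apply in_map_iff in Hp. destruct Hp as [i [<- Hi]].
  apply in_seq in Hi. apply Ht. lia.
- intros i j Hij. rewrite L in Hij. rewrite !Nth by lia. apply Hs; lia.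
- intro f. rewrite HQ. clear. induction N as [|N IH].
  + simpl. now rewrite sum_n_m_zero by lia.
  + rewrite seq_S, map_app, lsum_app, <- IH, sum_n_Sm by lia.
    change (sum_n_m (fun i => a i * f (tau i)) 1 N + a (S N) * f (tau (S N)) =
      sum_n_m (fun i => a i * f (tau i)) 1 N + (a (S N) * f (tau (S N)) + 0)).
    ring.
Qed.

Lemma Qn5_quadrature (n : nat) : (3 <= n)%nat -> quadrature_formula (n + 5) (Qn5 n).
Proof.
intro Hn.
assert (Hn3 : 3 <= INR n) by (apply (le_INR 3) in Hn; simpl in Hn; lra).
assert (Hi : 0 < / INR n) by (apply Rinv_0_lt_compat; lra).
assert (Hi1 : INR n * / INR n = 1) by (field; lra).
set (a := fun i : nat =>
  if orb (i =? 1)%nat (i =? n + 5)%nat then - (1 / (12 * INR n))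
  else if orb (i =? 2)%nat (i =? n + 4)%nat then 8 / (9 * INR n)
  else if orb (i =? 3)%nat (i =? n + 3)%nat then - (1 / (3 * INR n))
  else if orb (i =? 4)%nat (i =? n + 2)%nat then 37 / (36 * INR n)
  else 1 / INR n).
set (tau := fun i : nat =>
  if (i =? 1)%nat then 0 else if (i =? 2)%nat then 1 / (4 * INR n)
  else if (i =? 3)%nat then 1 / (2 * INR n)
  else if (i =? n + 3)%nat then 1 - 1 / (2 * INR n)
  else if (i =? n + 4)%nat then 1 - 1 / (4 * INR n)
  else if (i =? n + 5)%nat then 1 else INR (i - 3) / INR n).
assert (q4 : 1 / (4 * INR n) = / INR n / 4) by (field; lra).
assert (q2 : 1 / (2 * INR n) = / INR n / 2) by (field; lra).
assert (T1 : tau 1%nat = 0) by reflexivity.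
assert (T2 : tau 2%nat = 1 / (4 * INR n)) by reflexivity.
assert (T3 : tau 3%nat = 1 / (2 * INR n)) by reflexivity.
assert (Tm : forall i, (4 <= i <= n + 2)%nat -> tau i = INR (i - 3) * / INR n).
{ intros i Hi4. unfold tau.
  repeat match goal with |- context [(i =? ?k)%nat] =>
    rewrite (proj2 (Nat.eqb_neq i k)) by lia end. reflexivity. }
assert (T6 : tau (n + 3)%nat = 1 - 1 / (2 * INR n)).
{ unfold tau. rewrite Nat.eqb_refl.
  repeat match goal with |- context [(?i =? ?k)%nat] =>
    rewrite (proj2 (Nat.eqb_neq i k)) by lia end. reflexivity. }
assert (T7 : tau (n + 4)%nat = 1 - 1 / (4 * INR n)).
{ unfold tau. rewrite Nat.eqb_refl.
  repeat match goal with |- context [(?i =? ?k)%nat] =>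
    rewrite (proj2 (Nat.eqb_neq i k)) by lia end. reflexivity. }
assert (T8 : tau (n + 5)%nat = 1).
{ unfold tau. rewrite Nat.eqb_refl.
  repeat match goal with |- context [(?i =? ?k)%nat] =>
    rewrite (proj2 (Nat.eqb_neq i k)) by lia end. reflexivity. }
assert (Tlast : INR (n + 2 - 3) = INR n - 1).
{ rewrite minus_INR, plus_INR by lia. simpl. ring. }
assert (Step : forall i, (1 <= i)%nat -> (S i <= n + 5)%nat -> tau i < tau (S i)).
{ intros i H1 H5.
  destruct (Nat.eq_dec i 1) as [->|]; [rewrite T1, T2; lra|].
  destruct (Nat.eq_dec i 2) as [->|]; [rewrite T2, T3; lra|].
  destruct (Nat.eq_dec i 3) as [->|].
  { rewrite T3, (Tm 4%nat) by lia. simpl. lra. }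
  destruct (Nat.eq_dec i (n + 2)) as [->|].
  { replace (S (n + 2)) with (n + 3)%nat by lia. rewrite T6, Tm, Tlast by lia. lra. }
  destruct (Nat.eq_dec i (n + 3)) as [->|].
  { replace (S (n + 3)) with (n + 4)%nat by lia. rewrite T6, T7. lra. }
  destruct (Nat.eq_dec i (n + 4)) as [->|].
  { replace (S (n + 4)) with (n + 5)%nat by lia. rewrite T7, T8. lra. }
  rewrite !Tm by lia. replace (S i - 3)%nat with (S (i - 3)) by lia.
  rewrite S_INR. lra. }
assert (Mono : forall i j, (1 <= i)%nat -> (i < j)%nat -> (j <= n + 5)%nat -> tau i < tau j).
{ intros i j H1 Hij. induction Hij as [|j Hij IH]; intro H5.
  - now apply Step.
  - apply Rlt_trans with (tau j); [apply IH; lia|]. apply Step; lia. }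
exists a, tau. split; [|split; [exact Mono|]].
- intros i [H1 H5]. rewrite <- T1, <- T8 at 1. split.
  + destruct (Nat.eq_dec i 1) as [->|]; [lra|]. left. apply Mono; lia.
  + destruct (Nat.eq_dec i (n + 5)) as [->|]; [lra|]. left. apply Mono; lia.
- intro f. destruct (Nat.le_exists_sub 3 n Hn) as [j [Ej _]].
  replace (n + 5)%nat with (S (S (S (S (j + 4))))) by lia.
  rewrite 4!sum_n_Sm by lia. rewrite 4!sum_Sn_m by lia.
  repeat match goal with |- context [plus ?x ?y] => change (plus x y) with (x + y) end.
  replace (S (S (S (S (j + 4))))) with (n + 5)%nat by lia.
  replace (S (S (S (j + 4)))) with (n + 4)%nat by lia.
  replace (S (S (j + 4))) with (n + 3)%nat by lia.
  replace (S (j + 4)) with (n + 2)%nat by lia.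
  rewrite T1, T2, T3, T6, T7, T8, (Tm 4%nat), (Tm (n + 2)%nat), Tlast by lia.
  replace (sum_n_m (fun i => a i * f (tau i)) 5 (j + 4))
    with (1 / INR n * sum_n_m (fun k => f (INR k / INR n)) 2 (n - 2)).
  2:{ replace (n - 2)%nat with (j + 1)%nat by lia.
      replace (j + 4)%nat with (S (S (S (j + 1)))) by lia.
      rewrite <- (sum_n_m_S _ 4), <- (sum_n_m_S _ 3), <- (sum_n_m_S _ 2).
      rewrite <- (sum_n_m_mult_l (K := R_Ring) (1 / INR n) (fun k => f (INR k / INR n))).
      apply sum_n_m_ext_loc. intros k Hk. rewrite Tm by lia.
      replace (S (S (S k)) - 3)%nat with k by lia.
      unfold a. repeat match goal with |- context [(?i =? ?k)%nat] =>
        rewrite (proj2 (Nat.eqb_neq i k)) by lia end. reflexivity. }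
  unfold a. rewrite !Nat.eqb_refl.
  repeat match goal with |- context [(n + ?i =? ?k)%nat] =>
    rewrite (proj2 (Nat.eqb_neq (n + i) k)) by lia end.
  repeat match goal with |- context [(?i =? n + ?k)%nat] =>
    rewrite (proj2 (Nat.eqb_neq i (n + k))) by lia end.
  simpl orb. cbn [Nat.eqb]. cbv iota.
  unfold Qn5, Defs.sigma. replace (1 - 0) with 1 by ring.
  change (INR (4 - 3)) with 1.
  replace ((INR n - 1) * / INR n) with (1 - 1 / INR n) by (field; lra).
  replace (1 * / INR n) with (1 / INR n) by (field; lra).
  ring.
Qed.

(** * The error constant *)

(** A bound for the remainder from below, applied to [f] and to [- f], locates it
    between two values of the error constant times the fourth derivative. *)
Lemma error_constant_Qn5 (n : nat) : (3 <= n)%nat ->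
  is_error_constant4 (Qn5 n) (1 / (720 * INR n ^ 4) * (1 - 5 / (8 * INR n))).
Proof.
intro Hn.
assert (Hn3 : 3 <= INR n) by (apply (le_INR 3) in Hn; simpl in Hn; lra).
set (c := 1 / (720 * INR n ^ 4) * (1 - 5 / (8 * INR n))).
assert (Hc : 0 < c).
{ unfold c. apply Rmult_lt_0_compat.
  - apply Rdiv_lt_0_compat; [lra|]. assert (0 < INR n ^ 4) by (apply pow_lt; lra). lra.
  - assert (5 / (8 * INR n) < 1); [|lra].
    apply Rmult_lt_reg_r with (8 * INR n); [lra|]. field_simplify; lra. }
split; [exact Hc|]. intros f f4 Hf.
destruct (C4_extend f f4 Hf) as [F [F1 [F2 [F3 [F4 [HF [EF EF4]]]]]]].
destruct (quadrature_list _ _ (Qn5_quadrature n Hn)) as [q [_ [Hq [_ EQ]]]].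
assert (ER : remainder (Qn5 n) f = remainder (Qn5 n) F).
{ unfold remainder. f_equal.
  - apply RInt_ext. intros x Hx. rewrite Rmin_left, Rmax_right in Hx by lra.
    symmetry. apply EF. unfold I01; lra.
  - rewrite !EQ. apply lsum_ext. intros p Hp. symmetry. apply EF, (Hq p Hp). }
assert (C4 : forall x, continuity_pt F4 x).
{ intro x. apply continuity_pt_filterlim. apply HF. }
destruct (continuity_ab_min F4 0 1 Rle_0_1) as [u [Hu1 Hu2]]; [intros; apply C4|].
destruct (continuity_ab_maj F4 0 1 Rle_0_1) as [v [Hv1 Hv2]]; [intros; apply C4|].
assert (L := Qn5_lower n F F1 F2 F3 F4 (F4 u) Hn HF Hu1).
fold c in L.
assert (HG : C4_line (fun x => -1 * F x) (fun x => -1 * F1 x) (fun x => -1 * F2 x)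
  (fun x => -1 * F3 x) (fun x => -1 * F4 x)).
{ destruct HF as [D1 [D2 [D3 [D4 D5]]]].
  split; [|split; [|split; [|split]]]; intro x;
    try (apply is_derive_scal; auto).
  apply (continuous_mult (fun _ => -1) F4); [apply continuous_const|apply D5]. }
assert (U := Qn5_lower n _ _ _ _ _ (-1 * F4 v) Hn HG
  ltac:(intros x Hx; specialize (Hv1 x Hx); lra)).
fold c in U.
assert (EN : remainder (Qn5 n) (fun x => -1 * F x) = - remainder (Qn5 n) F).
{ unfold remainder. rewrite !EQ, lsum_scal.
  assert (ES : RInt (fun x => -1 * F x) 0 1 = -1 * RInt F 0 1).
  { apply (RInt_scal F 0 1 (-1)). now apply ex_RInt_derivable with F1, (proj1 HF). }
  rewrite ES. ring. }
rewrite EN in U. rewrite ER.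
set (r := remainder (Qn5 n) F) in *.
assert (B1 : F4 u <= r / c).
{ apply Rmult_le_reg_r with c; [exact Hc|]. unfold Rdiv.
  rewrite Rmult_assoc, Rinv_l, Rmult_1_r; lra. }
assert (B2 : r / c <= F4 v).
{ apply Rmult_le_reg_r with c; [exact Hc|]. unfold Rdiv.
  rewrite Rmult_assoc, Rinv_l, Rmult_1_r; lra. }
destruct (IVT_gen F4 u v (r / c)) as [xi [Hxi Exi]].
- intro x. apply C4.
- split; [eapply Rle_trans; [apply Rmin_l|exact B1]|eapply Rle_trans; [exact B2|apply Rmax_r]].
- assert (Hxi01 : 0 <= xi <= 1).
  { split.
    - apply Rle_trans with (2 := proj1 Hxi). apply Rmin_glb; lra.
    - apply Rle_trans with (1 := proj2 Hxi). apply Rmax_lub; lra. }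
  exists xi. split; [exact Hxi01|].
  rewrite <- EF4 by exact Hxi01. rewrite Exi. field. lra.
Qed.

(** * The Peano kernel of a positive definite formula *)

Lemma error_on_line (Q : (R -> R) -> R) (c : R) (f f1 f2 f3 f4 : R -> R) :
  is_error_constant4 Q c -> C4_line f f1 f2 f3 f4 ->
  exists xi, 0 <= xi <= 1 /\ RInt f 0 1 - Q f = c * f4 xi.
Proof. intros [_ HQ] Hf. apply HQ. eapply C4_I01_of_line, Hf. Qed.

Lemma is_RInt_truncated (s : R) (k : nat) : 0 <= s <= 1 ->
  is_RInt (fun x => pp (s - x) ^ (k + 1)) 0 1 (s ^ (k + 2) / INR (k + 2)).
Proof.
intro Hs. assert (HN : INR (k + 2) <> 0) by (apply not_0_INR; lia).
apply (is_RInt_primitive (fun x => - / INR (k + 2) * pp (s - x) ^ (k + 2))).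
- intro x. evar_last.
  + apply (is_derive_scal (fun x => pp (s - x) ^ (k + 2))), is_derive_pp_l.
  + eqR. field. exact HN.
- intro x. apply (continuous_comp (fun x => pp (s - x)) (fun y => y ^ (k + 1))).
  + apply (continuous_comp (fun x => s - x) pp); [|apply continuous_pp].
    apply (continuous_of_derive _ _ (-1)). auto_derive; [exact I|ring].
  + eapply continuous_of_derive. auto_derive; [exact I|reflexivity].
- rewrite (pp_neg (s - 1)), (pp_pos (s - 0)), pow_i by (lra || lia).
  rewrite Rminus_0_r. field. exact HN.
Qed.

Lemma mono_at_0 (q : list (R * R)) : in01 q -> mono q 0 = 0.
Proof.
intro Hq. unfold mono. rewrite (lsum_ext _ (fun _ => 0 * 0)).
- rewrite lsum_scal. field.
- intros p Hp. rewrite pp_neg by (destruct (Hq p Hp); lra). field.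
Qed.

(** The formula is exact for cubic polynomials. *)
Lemma mono_at_1 (Q : (R -> R) -> R) (c : R) (q : list (R * R)) :
  is_error_constant4 Q c -> in01 q -> (forall f, Q f = lsum f q) -> mono q 1 = 0.
Proof.
intros HQ Hq EQ.
destruct (error_on_line Q c (fun x => (1 - x) ^ 3 / 6) (fun x => - (1 - x) ^ 2 / 2)
  (fun x => 1 - x) (fun _ => -1) (fun _ => 0) HQ) as [xi [_ E]].
- split; [|split; [|split; [|split]]]; intro x;
    try (auto_derive; [exact I|simpl; field]). apply continuous_const.
- rewrite EQ in E.
  rewrite (is_RInt_unique _ 0 1 (1 / 24)) in E.
  + unfold mono. rewrite (lsum_ext _ (fun x => (1 - x) ^ 3 / 6)); [lra|].
    intros p Hp. rewrite pp_pos by (destruct (Hq p Hp); lra). reflexivity.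
  + apply (is_RInt_primitive (fun x => - (1 - x) ^ 4 / 24)).
    * intro x. auto_derive; [exact I|simpl; field].
    * intro x. eapply continuous_of_derive. auto_derive; [exact I|reflexivity].
    * field.
Qed.

(** The fourth derivative of [(1 - x)^4 / 24] is 1. *)
Lemma RInt_mono (Q : (R -> R) -> R) (c : R) (q : list (R * R)) :
  is_error_constant4 Q c -> in01 q -> (forall f, Q f = lsum f q) -> RInt (mono q) 0 1 = c.
Proof.
intros HQ Hq EQ.
destruct (error_on_line Q c (fun x => (1 - x) ^ 4 / 24) (fun x => - (1 - x) ^ 3 / 6)
  (fun x => (1 - x) ^ 2 / 2) (fun x => - (1 - x)) (fun _ => 1) HQ) as [xi [_ E]].
- split; [|split; [|split; [|split]]]; intro x;
    try (auto_derive; [exact I|simpl; field]). apply continuous_const.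
- rewrite EQ, Rmult_1_r in E. rewrite <- E.
  rewrite (is_RInt_unique (fun x => (1 - x) ^ 4 / 24) 0 1 (1 / 120)).
  + apply is_RInt_unique. unfold mono.
    apply @is_RInt_minus.
    * apply (is_RInt_primitive (fun x => x ^ 5 / 120)).
      -- intro x. auto_derive; [exact I|simpl; field].
      -- intro x. eapply continuous_of_derive. auto_derive; [exact I|reflexivity].
      -- field.
    * apply (is_RInt_lsum (fun s x => pp (x - s) ^ 3 / 6)). intros p Hp.
      destruct (Hq p Hp).
      apply (is_RInt_primitive (fun x => 0 * pp (x - snd p) ^ 2 + 0 * pp (x - snd p) ^ 3
        + / 24 * pp (x - snd p) ^ 4)).
      -- intro x. evar_last; [apply is_derive_pp_comb|simpl; field].
      -- intro x. eapply continuous_of_derive.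
         apply is_derive_ext with (fun x => 0 * pp (x - snd p) ^ 2
           + / 6 * pp (x - snd p) ^ 3 + 0 * pp (x - snd p) ^ 4).
         { intro t; simpl; field. }
         apply is_derive_pp_comb.
      -- rewrite (pp_neg (0 - snd p)), (pp_pos (1 - snd p)) by lra. field.
  + apply (is_RInt_primitive (fun x => - (1 - x) ^ 5 / 120)).
    * intro x. auto_derive; [exact I|simpl; field].
    * intro x. eapply continuous_of_derive. auto_derive; [exact I|reflexivity].
    * field.
Qed.

(** The second antiderivative of [mono q] is the error of the formula for the
    functions [(s - x)_+^5 / 120], whose fourth derivatives are convex in [s]. *)
Lemma mono_ge0 (Q : (R -> R) -> R) (c : R) (q : list (R * R)) :
  is_error_constant4 Q c -> in01 q -> (forall f, Q f = lsum f q) ->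
  forall s, 0 <= s <= 1 -> 0 <= mono q s.
Proof.
intros HQ Hq EQ s Hs.
destruct (Req_dec s 0) as [->|Hs0]; [rewrite mono_at_0; [lra|exact Hq]|].
destruct (Req_dec s 1) as [->|Hs1]; [rewrite (mono_at_1 Q c); [lra|assumption..]|].
destruct (Rle_dec 0 (mono q s)) as [H0|H0]; [exact H0|exfalso].
set (W := fun s => s ^ 6 / 720 - lsum (fun t => pp (s - t) ^ 5 / 120) q).
set (W1 := fun s => s ^ 5 / 120 - lsum (fun t => pp (s - t) ^ 4 / 24) q).
assert (DW : forall x, is_derive W x (W1 x)).
{ intro x. apply @is_derive_minus; [auto_derive; [exact I|simpl; field]|].
  apply (is_derive_lsum (fun t x => pp (x - t) ^ 5 / 120) (fun t x => pp (x - t) ^ 4 / 24)).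
  intro t. apply is_derive_ext with (fun x => / 120 * pp (x - t) ^ (3 + 2)).
  { intro y; simpl; field. }
  evar_last; [apply (is_derive_scal (fun x => pp (x - t) ^ (3 + 2))), is_derive_pp_r|].
  eqR. simpl; field. }
assert (DW1 : forall x, is_derive W1 x (mono q x)).
{ intro x. apply @is_derive_minus; [auto_derive; [exact I|simpl; field]|].
  apply (is_derive_lsum (fun t x => pp (x - t) ^ 4 / 24) (fun t x => pp (x - t) ^ 3 / 6)).
  intro t. apply is_derive_ext with (fun x => / 24 * pp (x - t) ^ (2 + 2)).
  { intro y; simpl; field. }
  evar_last; [apply (is_derive_scal (fun x => pp (x - t) ^ (2 + 2))), is_derive_pp_r|].
  eqR. simpl; field. }
(* The kernel is negative in a neighbourhood of [s] in [(0, 1)]. *)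
assert (Loc : exists d, 0 < d /\ 0 <= s - d /\ s + d <= 1 /\
  forall x, s - d <= x <= s + d -> mono q x < 0).
{ assert (Cm : continuity_pt (mono q) s) by apply continuity_pt_filterlim, continuous_mono.
  destruct (Cm (- mono q s) ltac:(lra)) as [d [Hd0 Hd]].
  assert (Hm : 0 < Rmin (d / 2) (Rmin s (1 - s))) by (repeat apply Rmin_pos; lra).
  assert (M1 := Rmin_l (d / 2) (Rmin s (1 - s))). assert (M2 := Rmin_r (d / 2) (Rmin s (1 - s))).
  assert (M3 := Rmin_l s (1 - s)). assert (M4 := Rmin_r s (1 - s)).
  exists (Rmin (d / 2) (Rmin s (1 - s))). repeat split; try lra.
  intros x Hx. destruct (Req_dec s x) as [<-|Hsx]; [lra|].
  assert (A : Rabs (mono q x - mono q s) < - mono q s).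
  { apply (Hd x). split; [split; [exact I|exact Hsx]|].
    simpl. unfold Rdist. apply Rabs_def1; lra. }
  apply Rabs_def2 in A. lra. }
destruct Loc as [d [Hd0 [Hd1 [Hd2 Hd]]]].
assert (Conc : W (s + d) - 2 * W s + W (s - d) < 0).
{ destruct (MVT_cor2 W W1 s (s + d) ltac:(lra)) as [x2 [E2 H2]].
  { intros; now apply is_derive_Reals. }
  destruct (MVT_cor2 W W1 (s - d) s ltac:(lra)) as [x1 [E1 H1]].
  { intros; now apply is_derive_Reals. }
  destruct (MVT_cor2 W1 (mono q) x1 x2 ltac:(lra)) as [x [E Hx]].
  { intros; now apply is_derive_Reals. }
  assert (mono q x < 0) by (apply Hd; lra).
  replace (s + d - s) with d in E2 by ring. replace (s - (s - d)) with d in E1 by ring.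
  assert (mono q x * (x2 - x1) < 0) by nra. nra. }
set (T := fun (k : nat) (b x : R) => b * (pp (s + d - x) ^ k + -2 * pp (s - x) ^ k + pp (s - d - x) ^ k)).
assert (DT : forall k b x, is_derive (T (k + 2)%nat b) x (T (k + 1)%nat (- INR (k + 2) * b) x)).
{ intros k b x. evar_last.
  - unfold T. apply (is_derive_scal (fun x => pp (s + d - x) ^ (k + 2)
      + -2 * pp (s - x) ^ (k + 2) + pp (s - d - x) ^ (k + 2)) x b).
    apply @is_derive_plus; [apply @is_derive_plus|apply is_derive_pp_l];
      [apply is_derive_pp_l|].
    apply (is_derive_scal (fun x => pp (s - x) ^ (k + 2)) x (-2)), is_derive_pp_l.
  - unfold T, plus; simpl. ring. }
destruct (error_on_line Q c (T 5%nat (/ 120)) (T 4%nat (- / 24)) (T 3%nat (/ 6))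
  (T 2%nat (- / 2)) (T 1%nat 1) HQ) as [xi [_ E]].
- split; [|split; [|split; [|split]]]; intro x.
  + evar_last; [apply (DT 3%nat)|]. simpl. unfold T; simpl; field.
  + evar_last; [apply (DT 2%nat)|]. simpl. unfold T; simpl; field.
  + evar_last; [apply (DT 1%nat)|]. simpl. unfold T; simpl; field.
  + evar_last; [apply (DT 0%nat)|]. simpl. unfold T; simpl; field.
  + assert (Cp : forall t, continuous (fun x => pp (t - x) ^ 1) x).
    { intro t. apply continuous_ext with (fun x => pp (t - x)); [intro; simpl; ring|].
      apply (continuous_comp (fun x => t - x) pp); [|apply continuous_pp].
      apply (continuous_of_derive _ _ (-1)). auto_derive; [exact I|ring]. }
    unfold T. apply (continuous_mult (fun _ => 1)); [apply continuous_const|].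
    apply (continuous_plus (fun x => pp (s + d - x) ^ 1 + -2 * pp (s - x) ^ 1)
      (fun x => pp (s - d - x) ^ 1)); [|apply Cp].
    apply (continuous_plus (fun x => pp (s + d - x) ^ 1) (fun x => -2 * pp (s - x) ^ 1));
      [apply Cp|].
    apply (continuous_mult (fun _ => -2) (fun x => pp (s - x) ^ 1));
      [apply continuous_const|apply Cp].
- assert (Pos : 0 <= T 1%nat 1 xi).
  { assert (A := pp_convex (s - d) s (s + d) xi ltac:(lra)).
    unfold T. rewrite !pow_1.
    replace (s + d - s) with d in A by ring. replace (s - (s - d)) with d in A by ring.
    replace (s + d - (s - d)) with (2 * d) in A by ring. nra. }
  assert (P : 0 <= c * T 1%nat 1 xi) by (destruct HQ; nra).
  rewrite <- E, EQ in P.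
  cut (RInt (T 5%nat (/ 120)) 0 1 - lsum (T 5%nat (/ 120)) q = W (s + d) - 2 * W s + W (s - d));
    [lra|].
  rewrite (is_RInt_unique _ 0 1
    (/ 120 * ((s + d) ^ 6 / 6 + -2 * (s ^ 6 / 6) + (s - d) ^ 6 / 6))).
  + rewrite (lsum_ext _ (fun t => (pp (s + d - t) ^ 5 / 120 + -2 * (pp (s - t) ^ 5 / 120))
      + pp (s - d - t) ^ 5 / 120)).
    * rewrite (lsum_plus (fun t => pp (s + d - t) ^ 5 / 120 + -2 * (pp (s - t) ^ 5 / 120))).
      rewrite (lsum_plus (fun t => pp (s + d - t) ^ 5 / 120)).
      rewrite (lsum_scal (-2) (fun t => pp (s - t) ^ 5 / 120)).
      unfold W. field.
    * intros p _. unfold T. field.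
  + assert (IR : forall t, 0 <= t <= 1 -> is_RInt (fun x => pp (t - x) ^ 5) 0 1 (t ^ 6 / 6)).
    { intros t Ht. assert (A := is_RInt_truncated t 4 Ht).
      replace (INR (4 + 2)) with 6 in A by (simpl; ring). exact A. }
    unfold T. apply (is_RInt_scal (fun x => pp (s + d - x) ^ 5 + -2 * pp (s - x) ^ 5
      + pp (s - d - x) ^ 5)).
    apply @is_RInt_plus; [apply @is_RInt_plus|]; [apply IR; lra| |apply IR; lra].
    apply (is_RInt_scal (fun x => pp (s - x) ^ 5)). apply IR; lra.
Qed.

Lemma error_constant_lower (N : nat) (Q : (R -> R) -> R) (c : R) :
  quadrature_formula N Q -> is_error_constant4 Q c -> 1 / (720 * (INR N + 5) ^ 4) <= c.
Proof.
intros Hf HQ. destruct (quadrature_list N Q Hf) as [q [<- [Hq [Sq EQ]]]].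
rewrite <- (RInt_mono Q c q HQ Hq EQ).
apply mono_lower; [exact Sq|]. exact (mono_ge0 Q c q HQ Hq EQ).
Qed.

Lemma c4_plus_bounds (n : nat) : (3 <= n)%nat ->
  1 / (720 * (INR n + 10) ^ 4) <= c4_plus (n + 5) <= c4 (Qn5 n).
Proof.
intro Hn. unfold c4_plus.
set (E := fun c => exists Q, quadrature_formula (n + 5) Q /\ positive_definite4 Q /\ c = c4 Q).
destruct (Glb_Rbar_correct E) as [G1 G2].
assert (U : Rbar_le (Glb_Rbar E) (c4 (Qn5 n))).
{ apply G1. exists (Qn5 n). split; [now apply Qn5_quadrature|split; [|reflexivity]].
  eexists. now apply error_constant_Qn5. }
assert (L : Rbar_le (1 / (720 * (INR n + 10) ^ 4)) (Glb_Rbar E)).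
{ apply G2. intros c [Q [HQ [[c' Hc'] ->]]]. rewrite (c4_unique Q c' Hc').
  assert (A := error_constant_lower _ Q c' HQ Hc').
  rewrite plus_INR in A. replace (INR 5) with 5 in A by (simpl; ring).
  replace (INR n + 5 + 5) with (INR n + 10) in A by ring. exact A. }
destruct (Glb_Rbar E) as [g| |]; simpl in *; try contradiction. now split.
Qed.

Theorem mainTheorem10 :
  (forall n : nat, (3 <= n)%nat ->
     quadrature_formula (n + 5) (Qn5 n) /\
     positive_definite4 (Qn5 n) /\
     c4 (Qn5 n) = 1 / (720 * INR n ^ 4) * (1 - 5 / (8 * INR n))) /\
  is_lim_seq (fun n : nat => c4 (Qn5 n) / c4_plus (n + 5)) 1.
Proof.
assert (C : forall n : nat, (3 <= n)%nat ->
  c4 (Qn5 n) = 1 / (720 * INR n ^ 4) * (1 - 5 / (8 * INR n))).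
{ intros n Hn. apply c4_unique. now apply error_constant_Qn5. }
split.
- intros n Hn. split; [now apply Qn5_quadrature|split; [|now apply C]].
  eexists. now apply error_constant_Qn5.
- apply (is_lim_seq_le_le_loc (fun _ => 1) _ (fun n => (1 + 10 * / INR n) ^ 4)).
  + exists 3%nat. intros n Hn.
    assert (Hn3 : 3 <= INR n) by (apply (le_INR 3) in Hn; simpl in Hn; lra).
    destruct (c4_plus_bounds n Hn) as [L U].
    assert (H10 : 0 < (INR n + 10) ^ 4) by (apply pow_lt; lra).
    assert (Hn4 : 0 < INR n ^ 4) by (apply pow_lt; lra).
    assert (L0 : 0 < 1 / (720 * (INR n + 10) ^ 4)) by (apply Rdiv_lt_0_compat; lra).
    assert (P0 : 0 < c4_plus (n + 5)) by lra.
    split.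
    * apply Rmult_le_reg_r with (c4_plus (n + 5)); [exact P0|].
      unfold Rdiv. rewrite Rmult_assoc, Rinv_l, Rmult_1_r, Rmult_1_l by lra. exact U.
    * apply Rmult_le_reg_r with (c4_plus (n + 5)); [exact P0|].
      unfold Rdiv at 1. rewrite Rmult_assoc, Rinv_l, Rmult_1_r by lra.
      apply Rle_trans with ((1 + 10 * / INR n) ^ 4 * (1 / (720 * (INR n + 10) ^ 4))).
      2:{ apply Rmult_le_compat_l; [|exact L]. apply pow_le.
          assert (0 < / INR n) by (apply Rinv_0_lt_compat; lra). lra. }
      rewrite C by exact Hn.
      replace ((1 + 10 * / INR n) ^ 4 * (1 / (720 * (INR n + 10) ^ 4)))
        with (1 / (720 * INR n ^ 4) * 1) by (field; lra).
      apply Rmult_le_compat_l.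
      -- left. apply Rdiv_lt_0_compat; lra.
      -- assert (0 < 5 / (8 * INR n)) by (apply Rdiv_lt_0_compat; lra). lra.
  + apply is_lim_seq_const.
  + assert (L : is_lim_seq (fun n => / INR n) 0).
    { apply (is_lim_seq_inv _ p_infty); [apply is_lim_seq_INR|easy]. }
    assert (L1 : is_lim_seq (fun n => 1 + 10 * / INR n) (1 + 10 * 0)).
    { apply is_lim_seq_plus'; [apply is_lim_seq_const|].
      apply (is_lim_seq_scal_l _ 10 0), L. }
    assert (L2 := is_lim_seq_mult' _ _ _ _ L1 (is_lim_seq_mult' _ _ _ _ L1
      (is_lim_seq_mult' _ _ _ _ L1 (is_lim_seq_mult' _ _ _ _ L1 (is_lim_seq_const 1))))).
    replace (Finite 1) with (Finite ((1 + 10 * 0) * ((1 + 10 * 0) * ((1 + 10 * 0)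
      * ((1 + 10 * 0) * 1))))) by (f_equal; ring).
    exact L2.
Qed.
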